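(* Suppose that $\mathbb M$ has definable Skolem functions. Let $X$ and $Y$ be Hausdorff definable spaces with $Y$ locally definably compact. Let $f:X\to Y$ be a continuous definable map. Then the following are equivalent: (1) $f$ is definably proper. (2) $f$ is definably closed and has definably compact fibers.
   Context: $\mathbb M=(M,<,\ldots)$ is an arbitrary o-minimal structure; ''definable'' means definable in $\mathbb M$, possibly with parameters. $\mathbb M$ has definable Skolem functions if for every uniformly definable family $\{F_t\}_{t\in T}$ of nonempty definable sets there is a definable map $f:T\to\bigcup_t F_t$ with $f(t)\in F_t$ for all $t\in T$. A definable space is a set $X=\bigcup_{i\le k}X_i$ with injections (definable charts) $\theta_i:X_i\to M^{n_i}$ ($i\le k$, $k$ finite) such that each $\theta_i(X_i)$ is a definable subset of $M^{n_i}$ (with the induced topology), each $\theta_i(X_i\cap X_j)$ is an open definable subset of $\theta_i(X_i)$, and each transition map $\theta_j\circ\theta_i^{-1}:\theta_i(X_i\cap X_j)\to\theta_j(X_i\cap X_j)$ is a definable homeomorphism. $X$ carries the topology in which each $X_i$ is open and each $\theta_i$ is a homeomorphism. A subset $A\subseteq X$ is definable if each $\theta_i(A\cap X_i)$ is definable; it is then itself a definable space with the induced topology. A map $f:X\to Y$ between definable spaces with charts $(X_i,\theta_i)$, $(Y_j,\delta_j)$ is definable if each $\delta_j\circ f\circ\theta_i^{-1}$ (on its natural domain) is a definable map between definable sets. A definable curve in a definable subset $C\subseteq X$ is a continuous definable map $\alpha:(a,b)\to C$, with $a<b$ in $M\cup\{-\infty,+\infty\}$; it is completable in $C$ if both limits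 $\lim_{t\to a^+}\alpha(t)$ and $\lim_{t\to b^-}\alpha(t)$ exist in $C$. $C$ is definably compact if every definable curve in $C$ is completable in $C$. $X$ is locally definably compact if every $x\in X$ has a definably compact (definable) neighborhood. A continuous definable map $f:X\to Y$ is definably proper if $f^{-1}(K)$ is a definably compact definable subset of $X$ for every definably compact definable subset $K$ of $Y$; it is definably closed if $f(A)$ is closed in $Y$ for every closed definable subset $A\subseteq X$. *)

(* Defs.v *)
From HB Require Import structures.
From mathcomp Require Import all_boot all_order all_algebra.
From mathcomp Require Import all_classical.
From mathcomp Require Import topology.
Set Implicit Arguments.
Unset Strict Implicit.
Unset Printing Implicit Defensive.
Import Order.TTheory.
Local Open Scope classical_set_scope.

(* The order symbol is part of the logic (constructor [Lt] below), so a
   language lists only the additional symbols; constants are function symbols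
   of arity 0.  The power M^n is 'rV[M]_n, whose library topology is the product
   topology. *)
Record language := Language {
  fun_symb : Type;
  fun_arity : fun_symb -> nat;
  rel_symb : Type;
  rel_arity : rel_symb -> nat }.

Record structure (L : language) (M : Type) := Structure {
  fun_interp : forall f : fun_symb L, 'rV[M]_(fun_arity f) -> M;
  rel_interp : forall r : rel_symb L, set 'rV[M]_(rel_arity r) }.

Inductive term (L : language) :=
| Var of nat
| App (f : fun_symb L) of 'I_(fun_arity f) -> term L.

(* De Bruijn indices: [Exists] binds variable 0 and shifts the others. *)
Inductive formula (L : language) :=
| Eq of term L & term L
| Lt of term L & term L
| Rel (r : rel_symb L) of 'I_(rel_arity r) -> term L
| Not of formula L
| And of formula L & formula L
| Exists of formula L.

Definition scons (M : Type) (a : M) (v : nat -> M) (k : nat) : M :=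
  if k is k'.+1 then v k' else a.

Section Semantics.
Context (L : language) (d : Order.disp_t) (M : orderTopologicalType d).
Variable S : structure L M.

Fixpoint eval (v : nat -> M) (t : term L) : M :=
  match t with
  | Var k => v k
  | App f ts => fun_interp S (\row_i eval v (ts i))%R
  end.

Fixpoint sat (v : nat -> M) (phi : formula L) : Prop :=
  match phi with
  | Eq t u => eval v t = eval v u
  | Lt t u => (eval v t < eval v u)%O
  | Rel r ts => rel_interp S (\row_i eval v (ts i))%R
  | Not psi => ~ sat v psi
  | And psi chi => sat v psi /\ sat v chi
  | Exists psi => exists a, sat (scons a v) psi
  end.

(* Variables 0, ..., n-1 are the coordinates of x; all the others are
   parameters. *)
Definition assign n (x : 'rV[M]_n) (p : nat -> M) (k : nat) : M :=
  if insub k is Some i then x ord0 i else p k.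

Definition definable n (A : set 'rV[M]_n) : Prop :=
  exists (phi : formula L) (p : nat -> M), A = [set x | sat (assign x p) phi].

(* The map v o u^-1, from u(D) to v(D), has a definable graph. *)
Definition definable_graph (T : Type) (D : set T) n m
    (u : T -> 'rV[M]_n) (v : T -> 'rV[M]_m) : Prop :=
  definable [set row_mx (u x) (v x) | x in D].

End Semantics.

Inductive endpoint (M : Type) := NInf | Fin of M | PInf.
Arguments NInf {M}.
Arguments PInf {M}.

Section OMinimal.
Context (d : Order.disp_t) (M : orderTopologicalType d).

Definition endpoint_lt (a b : endpoint M) : bool :=
  match a, b with
  | NInf, NInf => false
  | NInf, _ => true
  | Fin x, Fin y => (x < y)%O
  | Fin _, PInf => true
  | _, _ => false
  end.

Definition oint (a b : endpoint M) : set M :=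
  [set t | endpoint_lt a (Fin t) /\ endpoint_lt (Fin t) b].

(* Filters of t -> a^+ and t -> b^-. *)
Definition at_right_end (a : endpoint M) : set_system M :=
  [set A | exists2 c, endpoint_lt a (Fin c) & oint a (Fin c) `<=` A].

Definition at_left_end (b : endpoint M) : set_system M :=
  [set A | exists2 c, endpoint_lt (Fin c) b & oint (Fin c) b `<=` A].

Context (L : language) (S : structure L M).

(* O-minimal structures expand nonempty dense linear orders without
   endpoints. *)
Record o_minimal : Prop := OMinimal {
  om_inhabited : inhabited M;
  om_dense : forall x y : M, (x < y)%O -> exists2 z, (x < z)%O & (z < y)%O;
  om_no_min : forall x : M, exists y, (y < x)%O;
  om_no_max : forall x : M, exists y, (x < y)%O;
  om_tame : forall A : set M, definable S [set x : 'rV[M]_1 | A (x ord0 ord0)] ->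
    exists (k : nat) (p : 'I_k -> M) (l : nat) (e : 'I_l -> endpoint M * endpoint M),
      A = range p `|` \bigcup_i oint (e i).1 (e i).2 }.

(* The family (F t) for t in T is given by its total space in M^(n + m); the
   values of F and f outside T are irrelevant. *)
Definition has_definable_Skolem_functions : Prop :=
  forall (n m : nat) (T : set 'rV[M]_n) (F : 'rV[M]_n -> set 'rV[M]_m),
    definable S T ->
    definable S [set w : 'rV[M]_(n + m) | T (lsubmx w) /\ F (lsubmx w) (rsubmx w)] ->
    (forall t, T t -> F t !=set0) ->
    exists f : 'rV[M]_n -> 'rV[M]_m,
      definable_graph S T id f /\ (forall t, T t -> F t (f t)).

End OMinimal.

Definition rel_open (T : topologicalType) (B A : set T) : Prop :=
  exists2 U, open U & A = B `&` U.

(* [chart i] is only meaningful on [chart_dom i].  The witness h in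
   [transition_continuous] agrees with the transition map
   [chart j o (chart i)^-1] on its domain; since i and j are arbitrary, the
   transition maps are homeomorphisms. *)
Record definable_space (L : language) (d : Order.disp_t)
    (M : orderTopologicalType d) (S : structure L M) := DefinableSpace {
  space_sort :> Type;
  nb_charts : nat;
  chart_dim : 'I_nb_charts -> nat;
  chart_dom : 'I_nb_charts -> set space_sort;
  chart : forall i, space_sort -> 'rV[M]_(chart_dim i);
  chart_cover : \bigcup_i chart_dom i = setT;
  chart_inj : forall i x y, chart_dom i x -> chart_dom i y ->
    chart i x = chart i y -> x = y;
  chart_image_definable : forall i, definable S (chart i @` chart_dom i);
  overlap_definable : forall i j,
    definable S (chart i @` (chart_dom i `&` chart_dom j));
  overlap_open : forall i j,
    rel_open (chart i @` chart_dom i) (chart i @` (chart_dom i `&` chart_dom j));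
  transition_definable : forall i j,
    definable_graph S (chart_dom i `&` chart_dom j) (chart i) (chart j);
  transition_continuous : forall i j,
    exists2 h : 'rV[M]_(chart_dim i) -> 'rV[M]_(chart_dim j),
      (forall x, chart_dom i x -> chart_dom j x -> h (chart i x) = chart j x) &
      {within chart i @` (chart_dom i `&` chart_dom j), continuous h} }.

Section SpaceTopology.
Context (L : language) (d : Order.disp_t) (M : orderTopologicalType d).
Context (S : structure L M) (X : definable_space S).

Definition space_open (U : set X) : Prop :=
  forall i, rel_open (chart i @` chart_dom i) (chart i @` (U `&` chart_dom i)).

Lemma space_openT : space_open setT.
Proof. by move=> i; exists setT; [exact: openT | rewrite setTI setIT]. Qed.

Lemma space_openI : setI_closed space_open.
Proof.
move=> U V oU oV i; have [A oA eA] := oU i; have [B oB eB] := oV i.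
exists (A `&` B); first exact: openI.
apply/seteqP; split=> [_ [x [[Ux Vx] Dx] <-]|z [[x Dx <-] [Ax Bx]]].
  split; first by exists x.
  have : (chart i @` chart_dom i `&` A) (chart i x) by rewrite -eA; exists x.
  have : (chart i @` chart_dom i `&` B) (chart i x) by rewrite -eB; exists x.
  by move=> [_ Bx] [_ Ax].
have [y [Uy Dy] /(chart_inj Dy Dx) eyx] : (chart i @` (U `&` chart_dom i)) (chart i x).
  by rewrite eA; split=> //; exists x.
have [z' [Vz Dz] /(chart_inj Dz Dx) ezx] : (chart i @` (V `&` chart_dom i)) (chart i x).
  by rewrite eB; split=> //; exists x.
by subst; exists x.
Qed.

Lemma space_open_bigU (I : Type) (f : I -> set X) :
  (forall k, space_open (f k)) -> space_open (\bigcup_k f k).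
Proof.
move=> of_ i.
have [A hA] : {A : I -> set 'rV[M]_(chart_dim i) & forall k, open (A k) /\
    chart i @` (f k `&` chart_dom i) = chart i @` chart_dom i `&` A k}.
  apply: (@choice _ _ (fun k B => open B /\ chart i @` (f k `&` chart_dom i) =
    chart i @` chart_dom i `&` B)) => k.
  by have [A oA eA] := of_ k i; exists A.
exists (\bigcup_k A k); first by apply: bigcup_open => k _; case: (hA k).
apply/seteqP; split=> [_ [x [[k _ fx] Dx] <-]|z [[x Dx <-] [k _ Ax]]].
  have [_ eA] := hA k.
  have : (chart i @` chart_dom i `&` A k) (chart i x) by rewrite -eA; exists x.
  by case=> ? ?; split=> //; exists k.
have [_ eA] := hA k.
have [y [fy Dy] eyx] : (chart i @` (f k `&` chart_dom i)) (chart i x).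
  by rewrite eA; split=> //; exists x.
by exists y => //; split=> //; exists k.
Qed.

End SpaceTopology.

HB.instance Definition _ (L : language) (d : Order.disp_t)
  (M : orderTopologicalType d) (S : structure L M) (X : definable_space S) :=
  gen_eqMixin (space_sort X).
HB.instance Definition _ (L : language) (d : Order.disp_t)
  (M : orderTopologicalType d) (S : structure L M) (X : definable_space S) :=
  gen_choiceMixin (space_sort X).
HB.instance Definition _ (L : language) (d : Order.disp_t)
  (M : orderTopologicalType d) (S : structure L M) (X : definable_space S) :=
  isOpenTopological.Build (space_sort X) (@space_openT L d M S X)
    (@space_openI L d M S X) (@space_open_bigU L d M S X).

Section SpaceTopologyTheory.
Context (L : language) (d : Order.disp_t) (M : orderTopologicalType d).
Context (S : structure L M) (X : definable_space S).

Lemma open_spaceE (U : set X) : open U = space_open U.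
Proof. by []. Qed.

Lemma open_chart_dom (i : 'I_(nb_charts X)) : open (chart_dom i : set X).
Proof. by move=> j; rewrite setIC; exact: overlap_open. Qed.

(* With [open_chart_dom]: each chart is a homeomorphism onto its image. *)
Lemma open_chartE (i : 'I_(nb_charts X)) (U : set X) : U `<=` chart_dom i ->
  open U <-> rel_open (chart i @` chart_dom i) (chart i @` U).
Proof.
move=> UD; rewrite open_spaceE; split=> [oU|[V oV eV] j].
  by have := oU i; rewrite (setIidl UD).
have [h hE /continuousP/= hc] := transition_continuous j i.
have /open_subspaceP [W oW eW] := hc _ oV.
have [W' oW' eW'] := overlap_open j i.
exists (W' `&` W); first exact: openI.
have VU x : chart_dom i x -> V (chart i x) -> U x.
  move=> Dx Vx; have : (chart i @` chart_dom i `&` V) (chart i x).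
    by split=> //; exists x.
  by rewrite -eV => -[y Uy /(chart_inj (UD _ Uy) Dx) <-].
have hW z : (chart j @` (chart_dom j `&` chart_dom i)) z -> W z <-> V (h z).
  move=> Dz; have := congr1 (fun A => A z) eW; rewrite /setI /preimage/= => e.
  split=> Hz.
    have : W z /\ (chart j @` (chart_dom j `&` chart_dom i)) z by [].
    by rewrite e => -[].
  have : V (h z) /\ (chart j @` (chart_dom j `&` chart_dom i)) z by [].
  by rewrite -e => -[].
apply/seteqP; split=> [_ [x [Ux Dx] <-]|z [[x Dx <-] [W'x Wx]]].
  have Dix := UD _ Ux.
  have Ox : (chart j @` (chart_dom j `&` chart_dom i)) (chart j x) by exists x.
  split; first by exists x.
  split; first by move: Ox; rewrite eW' => -[].
  apply/(hW _ Ox); rewrite hE //.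
  have : (chart i @` U) (chart i x) by exists x.
  by rewrite eV => -[].
have Ox : (chart j @` (chart_dom j `&` chart_dom i)) (chart j x).
  by rewrite eW'; split=> //; exists x.
have [y [Djy Diy] /(chart_inj Djy Dx) eyx] := Ox; subst y.
exists x => //; split=> //; apply: VU => //.
by move/(hW _ Ox): Wx; rewrite hE.
Qed.
End SpaceTopologyTheory.

Section DefinableCompactness.
Context (L : language) (d : Order.disp_t) (M : orderTopologicalType d).
Context (S : structure L M).
Implicit Types X Y : definable_space S.

Definition definable_subset X (A : set X) : Prop :=
  forall i, definable S (chart i @` (A `&` chart_dom i)).

Definition definable_map X Y (f : X -> Y) : Prop :=
  forall i j, definable_graph S (chart_dom i `&` f @^-1` chart_dom j)
    (chart i) (chart j \o f).

(* Only the restriction of alpha to the interval (a, b) matters. *)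
Definition definable_curve X (C : set X) (a b : endpoint M) (alpha : M -> X) : Prop :=
  [/\ endpoint_lt a b,
      alpha @` oint a b `<=` C,
      {within oint a b, continuous alpha} &
      forall j, definable_graph S (oint a b `&` alpha @^-1` chart_dom j)
        (fun t => const_mx t : 'rV[M]_1) (chart j \o alpha)].

Definition completable X (C : set X) (a b : endpoint M) (alpha : M -> X) : Prop :=
  (exists2 x, C x & alpha @ at_right_end a --> x) /\
  (exists2 x, C x & alpha @ at_left_end b --> x).

Definition definably_compact X (C : set X) : Prop :=
  forall a b alpha, definable_curve C a b alpha -> completable C a b alpha.

Definition locally_definably_compact X : Prop :=
  forall x : X, exists K : set X,
    [/\ definable_subset K, definably_compact K & nbhs x K].

Definition definably_proper X Y (f : X -> Y) : Prop :=
  forall K : set Y, definable_subset K -> definably_compact K ->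
    definable_subset (f @^-1` K) /\ definably_compact (f @^-1` K).

Definition definably_closed X Y (f : X -> Y) : Prop :=
  forall A : set X, definable_subset A -> closed A -> closed (f @` A).

Definition definably_compact_fibers X Y (f : X -> Y) : Prop :=
  forall y : Y, definable_subset (f @^-1` [set y]) /\
    definably_compact (f @^-1` [set y]).

End DefinableCompactness.

(* Main.v *)
Require Import Defs.
From mathcomp Require Import all_boot all_order all_algebra.
From mathcomp Require Import all_classical.
From mathcomp Require Import topology.
Set Implicit Arguments.
Unset Strict Implicit.
Unset Printing Implicit Defensive.
Import Order.TTheory.
Local Open Scope classical_set_scope.

(** Write [f : X -> Y] for the map of the theorem.

Suppose that [f] is closed with definably compact fibers, and let [alpha] be a
definable curve in the preimage of a definably compact set [K].  At an end of
its interval, [f o alpha] has a limit [y] in [K].  If [alpha] stays in the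
fiber of [y] near this end, it has a limit because the fiber is definably
compact.  Otherwise, by o-minimality, [f o alpha] avoids [y] near the end.  A
curve without a limit eventually avoids a neighborhood of every point, so the
image of a short final segment of [alpha] would be a closed set
([closed_image_of_escaping_curve]); its image under [f] would be closed, have
[y] in its closure and not contain [y].

Conversely let [f] be proper, [A] be closed and [y] be in the closure of
[f(A)].  A point of the closure of a definable set need not be the limit of a
definable curve in it: the sides of a box around the point may have no
definable relation to one another.  Iterated limits replace curves.  Definable
Skolem functions pick, for every box [v] around [y], a point [c(v)] of [A]
whose image lies in [v] and in a fixed definably compact neighborhood [K] of
[y] ([definable_box_choice]).  The [c(v)] lie in the definably compact set
[f^-1(K)], so one can let the sides of [v] tend to [y] one after the other: a
limit in one side exists pointwise, and depends definably on the others because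
[X] is Hausdorff, which makes the next limit possible ([coordinate_limit],
[iterated_limit]).  Unwinding the limits, every
neighborhood of the final point [z] contains some [c(v)] with [v] as small as
desired; hence [z] is in [A], and [f(z) = y] because [Y] is Hausdorff.

Both directions apply definable compactness to definable functions on an
interval, and so need these to be continuous near the ends of the interval.
This is the part of the monotonicity theorem that is proved here
([eventually_continuous]); its core is that the points of an interval cannot
all be strict local minima ([no_interval_of_local_minima]). *)

(** * Definable predicates *)

Fixpoint rename_term L (r : nat -> nat) (t : term L) : term L :=
  match t with
  | Var k => Var L (r k)
  | App f ts => App (fun i => rename_term r (ts i))
  end.

Definition rename_up (r : nat -> nat) (k : nat) : nat :=
  if k is k'.+1 then (r k').+1 else 0.

Fixpoint rename L (r : nat -> nat) (phi : formula L) : formula L :=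
  match phi with
  | Eq t u => Eq (rename_term r t) (rename_term r u)
  | Lt t u => Lt (rename_term r t) (rename_term r u)
  | Rel R ts => Rel (fun i => rename_term r (ts i))
  | Not psi => Not (rename r psi)
  | And psi chi => And (rename r psi) (rename r chi)
  | Exists psi => Exists (rename (rename_up r) psi)
  end.

Section Definability.
Context (L : language) (d : Order.disp_t) (M : orderTopologicalType d).
Variable S : structure L M.

Lemma eval_rename (r : nat -> nat) (v : nat -> M) (t : term L) :
  Defs.eval S v (rename_term r t) = Defs.eval S (v \o r) t.
Proof.
elim: t => //= g ts IH; congr (fun_interp S _).
by apply/rowP => i; rewrite !mxE.
Qed.

Lemma sat_rename (phi : formula L) : forall (r : nat -> nat) (v : nat -> M),
  sat S v (rename r phi) <-> sat S (v \o r) phi.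
Proof.
elim: phi => [t u|t u|R ts|psi IH|psi IHp chi IHc|psi IH] r v /=.
- by rewrite !eval_rename.
- by rewrite !eval_rename.
- suff -> : (\row_i Defs.eval S v (rename_term r (ts i)))%R =
    (\row_i Defs.eval S (v \o r) (ts i))%R by [].
  by apply/rowP => i; rewrite !mxE eval_rename.
- by rewrite IH.
- by rewrite IHp IHc.
- have e a : scons a v \o rename_up r = scons a (v \o r) by apply/funext => -[].
  by split=> -[a /=]; [rewrite IH e|rewrite -e -IH] => ?; exists a.
Qed.

(** Contexts replace de Bruijn indices: a relation between points of several
powers of [M] is a predicate on the product of these powers, and only the
coordinate functions [K -> M] matter for its definability. *)
Class context (K : Type) := coordinate : set (K -> M).

#[export] Instance context_scalar : context M := [set id].
#[export] Instance context_row n : context 'rV[M]_n :=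
  [set g | exists i, g = fun x : 'rV[M]_n => x ord0 i].
#[export] Instance context_prod (K K' : Type) (cK : context K) (cK' : context K') :
  context (K * K') :=
  [set g | (exists2 h, coordinate h & g = h \o fst) \/
           (exists2 h, coordinate h & g = h \o snd)].

Definition coord_or_param (K : Type) (cK : context K) (g : K -> M) : Prop :=
  coordinate g \/ exists a, g = cst a.

(** The maps along which a formula can be pulled back by renaming its
variables, without introducing quantifiers. *)
Definition substitution (K K' : Type) {cK : context K} {cK' : context K'}
    (tau : K -> K') : Prop :=
  forall g, coordinate g -> coord_or_param cK (g \o tau).

(** The variables of [phi] are interpreted by arbitrary coordinates and
parameters, in no fixed order, so that combining formulas never requires
reconciling two lists of parameters. *)
Definition definable_pred (K : Type) {cK : context K} (P : K -> Prop) : Prop :=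
  exists (phi : formula L) (s : nat -> K -> M),
    (forall k, coord_or_param cK (s k)) /\
    forall x, P x <-> sat S (fun k => s k x) phi.

Section Closure.
Context (K : Type) {cK : context K}.
Implicit Types P Q : K -> Prop.

Lemma definable_pred_ext P Q : (forall x, P x <-> Q x) ->
  definable_pred P -> definable_pred Q.
Proof.
move=> PQ [phi [s [sc sE]]]; exists phi, s; split=> // x.
by rewrite -PQ.
Qed.

Lemma definable_not P : definable_pred P -> definable_pred (fun x => ~ P x).
Proof.
move=> [phi [s [sc sE]]]; exists (Not phi), s; split=> // x /=.
by rewrite sE.
Qed.

Lemma definable_and P Q : definable_pred P -> definable_pred Q ->
  definable_pred (fun x => P x /\ Q x).
Proof.
move=> [phi [s [sc sE]]] [psi [t [tc tE]]].
(* The two formulas use the even and the odd variables respectively. *)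
exists (And (rename (fun k => k.*2) phi) (rename (fun k => k.*2.+1) psi)).
exists (fun k => if odd k then t k./2 else s k./2); split=> [k|x /=].
  by case: ifP.
rewrite sE tE !sat_rename.
have -> : (fun k => (if odd k then t k./2 else s k./2) x) \o (fun k => k.*2) =
    s^~ x by apply/funext => k /=; rewrite odd_double doubleK.
have -> // : (fun k => (if odd k then t k./2 else s k./2) x) \o (fun k => k.*2.+1) =
    t^~ x by apply/funext => k /=; rewrite odd_double /= uphalf_double.
Qed.

Lemma definable_or P Q : definable_pred P -> definable_pred Q ->
  definable_pred (fun x => P x \/ Q x).
Proof.
move=> dP dQ.
apply: (@definable_pred_ext (fun x => ~ (~ P x /\ ~ Q x))).
  by move=> x; rewrite not_andE !notE.
by apply: definable_not; apply: definable_and; apply: definable_not.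
Qed.

Lemma definable_imp P Q : definable_pred P -> definable_pred Q ->
  definable_pred (fun x => P x -> Q x).
Proof.
move=> dP dQ.
apply: (@definable_pred_ext (fun x => ~ P x \/ Q x)); last first.
  by apply: definable_or => //; apply: definable_not.
by move=> x; rewrite implyE.
Qed.

Lemma definable_iff P Q : definable_pred P -> definable_pred Q ->
  definable_pred (fun x => P x <-> Q x).
Proof. by move=> dP dQ; apply: definable_and; apply: definable_imp. Qed.

Lemma definable_eq (g h : K -> M) : substitution g -> substitution h ->
  definable_pred (fun x => g x = h x).
Proof.
move=> sg sh; exists (Eq (Var L 0) (Var L 1)).
exists (fun k => if k is 0 then g else h); split=> // -[|k].
- exact: (sg id).
- exact: (sh id).
Qed.

Lemma definable_lt (g h : K -> M) : substitution g -> substitution h ->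
  definable_pred (fun x => (g x < h x)%O).
Proof.
move=> sg sh; exists (Lt (Var L 0) (Var L 1)).
exists (fun k => if k is 0 then g else h); split=> // -[|k].
- exact: (sg id).
- exact: (sh id).
Qed.

Lemma definable_le (g h : K -> M) : substitution g -> substitution h ->
  definable_pred (fun x => (g x <= h x)%O).
Proof.
move=> sg sh; apply: (@definable_pred_ext (fun x => ~ (h x < g x)%O)).
  by move=> x; rewrite leNgt; split=> /negP.
by apply: definable_not; apply: definable_lt.
Qed.

End Closure.

Hypothesis M0 : inhabited M.

Section Quantifiers.
Context (K : Type) {cK : context K}.

Lemma definable_cst (P : Prop) : definable_pred (fun _ : K => P).
Proof.
case: M0 => a.
have dT : definable_pred (fun _ : K => a = a).
  by apply: definable_eq => g ->; right; exists a.
have [p|np] := pselect P; first by apply: definable_pred_ext dT.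
by apply: definable_pred_ext (definable_not dT) => ?; split.
Qed.

Lemma definable_exists (P : K -> M -> Prop) :
  definable_pred (fun p : K * M => P p.1 p.2) ->
  definable_pred (fun x => exists a, P x a).
Proof.
case: M0 => a0 [phi [s [sc sE]]].
have sP k : exists h : K -> M, coord_or_param cK h /\ (s k <> snd -> s k = h \o fst).
  have [[[h hc ->]|[h -> ->]]|[a ->]] := sc k.
  - by exists h; split=> //; left.
  - by exists (cst a0); split=> //; right; exists a0.
  - by exists (cst a); split=> //; right; exists a.
(* The variables of phi that stand for the quantified element all become
   variable 0, the one bound by Exists. *)
have [t tP] := choice sP.
exists (Exists (rename (fun k => if `[< s k = snd >] then 0 else k.+1) phi)), t.
split=> [k|x /=]; first by have [] := tP k.
have e a : scons a (t^~ x) \o (fun k => if `[< s k = snd >] then 0 else k.+1) =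
    s^~ (x, a).
  apply/funext => k /=; case: asboolP => [->//|/= ne].
  by have [_ ->] := tP k.
split=> -[a]; first by rewrite (sE (x, a)) -e -sat_rename; exists a.
by rewrite sat_rename e -(sE (x, a)); exists a.
Qed.

Lemma definable_forall (P : K -> M -> Prop) :
  definable_pred (fun p : K * M => P p.1 p.2) ->
  definable_pred (fun x => forall a, P x a).
Proof.
move=> dP; apply: (definable_pred_ext (P := fun x => ~ exists a, ~ P x a)).
  by move=> x; rewrite -forallNE; split=> H a; [apply: contrapT|move=> /(_ (H a))].
by apply: definable_not; apply: definable_exists; exact: (definable_not dP).
Qed.

Lemma definable_exists_finite n (P : 'I_n -> K -> Prop) :
  (forall i, definable_pred (P i)) ->
  definable_pred (fun x => exists i, P i x).
Proof.
elim: n P => [|n IH] P dP.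
  apply: (definable_pred_ext _ (definable_cst False)) => x.
  by split=> // -[[]].
have dP' := definable_or (dP ord0) (IH (fun i => P (lift ord0 i)) (fun i => dP _)).
apply: definable_pred_ext dP' => x; split=> [[H|[i H]]|[i]].
- by exists ord0.
- by exists (lift ord0 i).
- by case: (unliftP ord0 i) => [j|] ->; [right; exists j|left].
Qed.

Lemma definable_forall_finite n (P : 'I_n -> K -> Prop) :
  (forall i, definable_pred (P i)) ->
  definable_pred (fun x => forall i, P i x).
Proof.
move=> dP; have dN := definable_not
  (definable_exists_finite (fun i => definable_not (dP i))).
apply: definable_pred_ext dN => x; rewrite -forallNE.
by split=> H i; [apply: contrapT|move=> /(_ (H i))].
Qed.

End Quantifiers.

Section Substitutions.
Context (K : Type) {cK : context K}.

Lemma substitution_id : substitution (@id K).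
Proof. by move=> g cg; left. Qed.

Lemma substitution_cst (K' : Type) {cK' : context K'} (x : K') :
  substitution (fun _ : K => x).
Proof. by move=> g _; right; exists (g x). Qed.

Lemma substitution_comp (K1 K2 : Type) {c1 : context K1} {c2 : context K2}
    (tau : K -> K1) (rho : K1 -> K2) :
  substitution tau -> substitution rho -> substitution (fun x => rho (tau x)).
Proof.
move=> stau srho g /srho[/stau//|[a e]]; right; exists a.
by apply/funext => x; exact: (congr1 (@^~ (tau x)) e).
Qed.

Lemma substitution_fst (K1 K2 : Type) {c1 : context K1} {c2 : context K2}
    (tau : K -> K1 * K2) :
  substitution tau -> substitution (fun x => (tau x).1).
Proof.
move=> stau; apply: (substitution_comp (rho := fst) stau) => g cg.
by left; left; exists g.
Qed.

Lemma substitution_snd (K1 K2 : Type) {c1 : context K1} {c2 : context K2}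
    (tau : K -> K1 * K2) :
  substitution tau -> substitution (fun x => (tau x).2).
Proof.
move=> stau; apply: (substitution_comp (rho := snd) stau) => g cg.
by left; right; exists g.
Qed.

Lemma substitution_pair (K1 K2 : Type) {c1 : context K1} {c2 : context K2}
    (tau : K -> K1) (rho : K -> K2) :
  substitution tau -> substitution rho -> substitution (fun x => (tau x, rho x)).
Proof. by move=> stau srho g [[h ch ->]|[h ch ->]]; [exact: stau|exact: srho]. Qed.

Lemma substitution_coord n (tau : K -> 'rV[M]_n) (i : 'I_1) (j : 'I_n) :
  substitution tau -> substitution (fun x => tau x i j).
Proof.
move=> stau; apply: (substitution_comp (rho := fun y : 'rV[M]_n => y i j) stau) => g ->.
by left; exists j; rewrite ord1.
Qed.

Lemma substitution_matrix n (E : K -> 'I_1 -> 'I_n -> M) :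
  (forall i j, substitution (fun x => E x i j)) ->
  substitution (fun x => \matrix_(i, j) E x i j)%R.
Proof.
move=> sE g [j ->].
suff -> : (fun x : 'rV[M]_n => x ord0 j) \o (fun x => \matrix_(i, j) E x i j)%R =
    (fun x => E x ord0 j) by exact: (sE _ _ id).
by apply/funext => x /=; rewrite mxE.
Qed.

Lemma substitution_lsubmx n m (tau : K -> 'rV[M]_(n + m)) :
  substitution tau -> substitution (fun x => lsubmx (tau x)).
Proof.
move=> stau; apply: (substitution_comp (rho := @lsubmx _ _ _ _) stau) => g [j ->]; left.
by exists (lshift m j); apply/funext => x /=; rewrite mxE.
Qed.

Lemma substitution_rsubmx n m (tau : K -> 'rV[M]_(n + m)) :
  substitution tau -> substitution (fun x => rsubmx (tau x)).
Proof.
move=> stau; apply: (substitution_comp (rho := @rsubmx _ _ _ _) stau) => g [j ->]; left.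
by exists (rshift n j); apply/funext => x /=; rewrite mxE.
Qed.

Lemma substitution_row_mx n m (tau : K -> 'rV[M]_n) (rho : K -> 'rV[M]_m) :
  substitution tau -> substitution rho ->
  substitution (fun x => row_mx (tau x) (rho x)).
Proof.
move=> stau srho g [k ->] /=.
case: (split_ordP k) => j ->.
  have := substitution_coord ord0 j stau (erefl : coordinate id).
  by congr coord_or_param; apply/funext => x /=; rewrite row_mxEl.
have := substitution_coord ord0 j srho (erefl : coordinate id).
by congr coord_or_param; apply/funext => x /=; rewrite row_mxEr.
Qed.

Lemma substitution_const_mx n (tau : K -> M) :
  substitution tau -> substitution (fun x => const_mx (tau x) : 'rV[M]_n).
Proof.
move=> stau g [j ->]; have := stau id erefl.
by congr coord_or_param; apply/funext => x /=; rewrite mxE.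
Qed.

Lemma substitution_if (b : bool) (K' : Type) {cK' : context K'} (tau rho : K -> K') :
  substitution tau -> substitution rho ->
  substitution (fun x => if b then tau x else rho x).
Proof. by case: b. Qed.

Lemma definable_subst (K' : Type) {cK' : context K'} (tau : K -> K') (P : K' -> Prop) :
  substitution tau -> definable_pred P -> definable_pred (fun x => P (tau x)).
Proof.
move=> stau [phi [s [sc sE]]]; exists phi, (fun k => s k \o tau).
split=> [k|x]; last by rewrite sE.
by have [/stau //|[a ->]] := sc k; right; exists a.
Qed.

Lemma definable_mem n (A : set 'rV[M]_n) (tau : K -> 'rV[M]_n) :
  definable S A -> substitution tau -> definable_pred (fun x => A (tau x)).
Proof.
move=> [phi [p ->]] stau; apply: (definable_subst stau).
exists phi, (fun k x => assign x p k); split=> // k.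
rewrite /assign; case: insub => [i|]; first by left; exists i.
by right; exists (p k).
Qed.

End Substitutions.

(** The bridge with definable sets: a point of [M^n] assigns its coordinates
to the first [n] variables, and leaves infinitely many others for the
parameters of the formula. *)
Lemma definable_predP n (A : set 'rV[M]_n) : definable S A <-> definable_pred A.
Proof.
split=> [dA|[phi [s [sc sE]]]].
  by apply: (definable_mem dA); exact: substitution_id.
pose is_coord k (i : 'I_n) := s k = fun x => x ord0 i.
have sP k : (exists i, is_coord k i) \/ (exists a, s k = cst a) by exact: sc.
case: M0 => a0.
have rP k : exists r : nat * M,
    (exists2 i : 'I_n, is_coord k i & r.1 = i) \/ (r.1 = n + k /\ s k = cst r.2).
  have [[i e]|[a e]] := sP k; last by exists (n + k, a); right.
  by exists (nat_of_ord i, a0); left; exists i.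
have [r {}rP] := choice rP.
(* Variables that stand for parameters are moved beyond the n coordinates. *)
exists (rename (fun k => (r k).1) phi), (fun k => (r (k - n)).2).
suff e x : assign x (fun k => (r (k - n)).2) \o (fun k => (r k).1) = s^~ x.
  by apply/seteqP; split=> x /=; rewrite sE sat_rename e.
apply/funext => k /=; rewrite /assign.
have [[i ci ->]|[-> ->]] := rP k; first by rewrite valK ci.
by rewrite insubF ?addKn // ltnNge leq_addr.
Qed.

Lemma definable_eq_row n (K : Type) {cK : context K} (tau rho : K -> 'rV[M]_n) :
  substitution tau -> substitution rho -> definable_pred (fun x => tau x = rho x).
Proof.
move=> stau srho.
apply: (definable_pred_ext (P := fun x => forall i, tau x ord0 i = rho x ord0 i)).
  by move=> x; split=> [H|-> //]; apply/rowP.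
by apply: definable_forall_finite => i; apply: definable_eq; exact: substitution_coord.
Qed.

Lemma definable_exists_row n (K : Type) {cK : context K} (P : K -> 'rV[M]_n -> Prop) :
  definable_pred (fun p : K * 'rV[M]_n => P p.1 p.2) ->
  definable_pred (fun x => exists z, P x z).
Proof.
elim: n K cK P => [|n IH] K cK P dP.
  case: M0 => a0; pose z0 : 'rV[M]_0 := const_mx a0.
  have sz : substitution (fun x : K => (x, z0)).
    by apply: substitution_pair; [exact: substitution_id|exact: substitution_cst].
  apply: definable_pred_ext (definable_subst sz dP) => x /=.
  split=> [?|[z]]; first by exists z0.
  by have -> : z = z0 by apply/rowP => -[].
have {}dP : definable_pred (fun p : K * 'rV[M]_(1 + n) => P p.1 p.2) := dP.
pose tau (p : K * M * 'rV[M]_n) : K * 'rV[M]_(1 + n) :=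
  (p.1.1, row_mx (const_mx p.1.2 : 'rV[M]_1) p.2).
have stau : substitution tau.
  apply: substitution_pair; first by do 2!apply: substitution_fst; exact: substitution_id.
  apply: substitution_row_mx; last by apply: substitution_snd; exact: substitution_id.
  apply: substitution_const_mx; apply: substitution_snd.
  by apply: substitution_fst; exact: substitution_id.
have dQ : definable_pred (fun x => exists a, exists z : 'rV[M]_n,
    P x (row_mx (const_mx a : 'rV[M]_1) z)).
  apply: definable_exists => /=.
  exact: (IH (K * M)%type _ (fun p z => P p.1 (row_mx (const_mx p.2 : 'rV[M]_1) z))
    (definable_subst stau dP)).
apply: definable_pred_ext dQ => x; split=> [[a [z]]|[z]] /=.
  by move=> Pxz; exists (row_mx (const_mx a : 'rV[M]_1) z).
exists (z ord0 ord0), (rsubmx (z : 'rV_(1 + n))).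
suff -> : row_mx (const_mx (z ord0 ord0) : 'rV[M]_1) (rsubmx (z : 'rV_(1 + n))) = z by [].
rewrite -[RHS](@hsubmxK _ 1 1 n); congr row_mx.
by apply/rowP => j; rewrite !mxE !ord1; congr (z _ _); apply/val_inj.
Qed.

Lemma definable_forall_row n (K : Type) {cK : context K} (P : K -> 'rV[M]_n -> Prop) :
  definable_pred (fun p : K * 'rV[M]_n => P p.1 p.2) ->
  definable_pred (fun x => forall z, P x z).
Proof.
move=> dP; apply: (definable_pred_ext (P := fun x => ~ exists a, ~ P x a)).
  by move=> x; rewrite -forallNE; split=> H a; [apply: contrapT|move=> /(_ (H a))].
by apply: definable_not; apply: definable_exists_row; exact: (definable_not dP).
Qed.

End Definability.

Ltac substitution_tac :=
  lazymatch goal with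
  | |- forall _, _ => move=> ?; substitution_tac
  | |- _ => first
    [ exact: substitution_id | exact: substitution_cst | assumption
    | match goal with
      | H : substitution ?rho |- _ => apply: (substitution_comp (rho := rho) _ H); substitution_tac
      end
    | apply: substitution_fst; substitution_tac
    | apply: substitution_snd; substitution_tac
    | apply: substitution_pair; substitution_tac
    | apply: substitution_coord; substitution_tac
    | apply: substitution_row_mx; substitution_tac
    | apply: substitution_lsubmx; substitution_tac
    | apply: substitution_rsubmx; substitution_tac
    | apply: substitution_const_mx; substitution_tac
    | apply: substitution_if; substitution_tac
    | apply: substitution_matrix; substitution_tac ]
  end.

Ltac definable_tac :=
  try assumption;
  lazymatch goal with
  | |- forall _, _ => move=> ? /=; definable_tac
  | |- inhabited _ => assumption
  | |- substitution _ => substitution_tac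
  | |- definable_pred _ (fun x => _ /\ _) => apply: definable_and; definable_tac
  | |- definable_pred _ (fun x => _ \/ _) => apply: definable_or; definable_tac
  | |- definable_pred _ (fun x => _ <-> _) => apply: definable_iff; definable_tac
  | |- definable_pred _ (fun x => ~ _) => apply: definable_not; definable_tac
  | |- definable_pred _ (fun x => is_true (_ < _)%O) => apply: definable_lt; substitution_tac
  | |- definable_pred _ (fun x => is_true (_ <= _)%O) => apply: definable_le; substitution_tac
  | |- definable_pred _ (fun x => exists _, _) =>
      first [ apply: definable_exists_finite | apply: definable_exists_row
            | apply: definable_exists ] => /=; definable_tac
  | |- definable_pred _ (fun x => _ = _) =>
      first [ apply: definable_eq; definable_tac | apply: definable_eq_row; definable_tac | idtac ]
  | |- definable_pred _ (fun x => forall _, _) =>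
      first [ apply: definable_imp | apply: definable_forall_finite
            | apply: definable_forall_row | apply: definable_forall ] => /=; definable_tac
  | |- _ => try first [ assumption | by apply: definable_cst ]
  end.

(** * Germs of intervals and tameness of definable subsets of the line *)

Section Germs.
Context (d : Order.disp_t) (M : orderTopologicalType d).

(** A boolean orientation [s] lets one proof serve for right limits ([true])
and left limits ([false]), and for increasing and decreasing functions. *)
Definition oriented_lt (s : bool) (x y : M) : bool := if s then (x < y)%O else (y < x)%O.

Definition beyond (s : bool) (e : endpoint M) (t : M) : bool :=
  if s then endpoint_lt e (Fin t) else endpoint_lt (Fin t) e.

Definition germ (s : bool) (e : endpoint M) : set_system M :=
  [set A | exists2 c, beyond s e c &
    forall t, beyond s e t -> oriented_lt s t c -> A t].

Lemma germE s e : germ s e = if s then at_right_end e else at_left_end e.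
Proof.
apply/funext => A; apply/propext; case: s => /=.
  by split=> -[c ec H]; exists c => // t; [move=> [*]; apply: H|move=> *; apply: H].
by split=> -[c ec H]; exists c => // t; [move=> [*]; apply: H|move=> *; apply: H].
Qed.

Lemma oriented_lt_trans s : transitive (oriented_lt s).
Proof. by case: s => y x z; [exact: lt_trans|move=> /[swap]; exact: lt_trans]. Qed.

Lemma oriented_lt_irr s x : oriented_lt s x x = false.
Proof. by case: s; rewrite /= ltxx. Qed.

Lemma oriented_ltP s x y : [\/ oriented_lt s x y, x = y | oriented_lt s y x].
Proof.
by case: s => /=; case: (ltgtP x y) => ?;
  by [constructor 1|constructor 2|constructor 3].
Qed.

Lemma endpoint_lt_trans (e1 e2 e3 : endpoint M) :
  endpoint_lt e1 e2 -> endpoint_lt e2 e3 -> endpoint_lt e1 e3.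
Proof. by case: e1 e2 e3 => [|x|] [|y|] [|z|] //=; exact: lt_trans. Qed.

Lemma beyond_Fin s x t : beyond s (Fin x) t = oriented_lt s x t.
Proof. by case: s. Qed.

End Germs.

Section OMinimal.
Context (L : language) (d : Order.disp_t) (M : orderTopologicalType d).
Variable S : structure L M.
Hypothesis HM : o_minimal S.

Let M0 : inhabited M := om_inhabited HM.

Lemma oriented_dense s (x y : M) : oriented_lt s x y ->
  exists2 z, oriented_lt s x z & oriented_lt s z y.
Proof.
by case: s => /(om_dense HM) [z ? ?]; exists z.
Qed.

Lemma oriented_no_max s (x : M) : exists y, oriented_lt s x y.
Proof. by case: s; [exact: om_no_max HM x|exact: om_no_min HM x]. Qed.

Lemma beyond_dense s (e : endpoint M) c : beyond s e c ->
  exists2 t, beyond s e t & oriented_lt s t c.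
Proof.
case: e => [|x|]; rewrite ?beyond_Fin; last 2 first.
- by move=> /oriented_dense [z ? ?]; exists z; rewrite ?beyond_Fin.
- case: s => //= _; have [y cy] := om_no_max HM c; by exists y.
- case: s => //= _; have [y cy] := om_no_min HM c; by exists y.
Qed.

Lemma germ_proper s (e : endpoint M) c : beyond s e c -> ProperFilter (germ s e).
Proof.
move=> ec; split; first by move=> [c' /beyond_dense [t et tc] /(_ t et tc)].
split=> [|A B [a ea aA] [b eb bB]|A B AB [a ea aA]]; first by exists c.
  have [ab|eab|ba] := oriented_ltP s a b.
  - exists a => // t et ta; split; first exact: aA.
    by apply: bB => //; exact: oriented_lt_trans ab.
  - by subst b; exists a => // t et ta; split; [exact: aA|exact: bB].
  - exists b => // t et tb; split; last exact: bB.
    by apply: aA => //; exact: oriented_lt_trans ba.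
by exists a => // t et ta; apply: AB; exact: aA.
Qed.

Lemma germ_beyond s (e : endpoint M) c : beyond s e c ->
  germ s e (fun t => beyond s e t /\ oriented_lt s t c).
Proof. by move=> ec; exists c. Qed.

Lemma germ_Fin_proper s (x : M) : ProperFilter (germ s (Fin x)).
Proof.
by have [y xy] := oriented_no_max s x; apply: (@germ_proper _ _ y); rewrite beyond_Fin.
Qed.

Lemma germ_notin s (e : endpoint M) c (Z : seq M) : beyond s e c ->
  germ s e (fun t => t \notin Z).
Proof.
move=> ec; have PF := germ_proper ec.
elim: Z => [|z Z IH]; first by exists c.
have [ez|nez] := boolP (beyond s e z).
  apply: filterS2 IH (germ_beyond ez) => t tZ [_ tz].
  rewrite inE negb_or tZ andbT.
  by apply/eqP => tz'; rewrite tz' oriented_lt_irr in tz.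
apply: filterS2 IH (germ_beyond ec) => t tZ [et _].
rewrite inE negb_or tZ andbT.
by apply: contraNneq nez => <-.
Qed.

(** [Z] consists of the isolated points and of the endpoints of the intervals
that o-minimality provides. *)
Lemma definable_locally_constant (B : M -> Prop) : definable_pred S B ->
  exists Z : seq M, forall x y, (x < y)%O ->
    (forall z, (x <= z)%O -> (z <= y)%O -> z \notin Z) -> B x <-> B y.
Proof.
move=> dB.
have /(om_tame HM) [k [p [l [e eB]]]] : definable S [set x : 'rV[M]_1 | B (x ord0 ord0)].
  apply/definable_predP => //; apply: (definable_subst _ dB); substitution_tac.
pose pts (e : endpoint M) := if e is Fin z then [:: z] else [::].
exists ([seq p i | i : 'I_k] ++
  flatten [seq pts (e i).1 ++ pts (e i).2 | i : 'I_l]) => x y xy nZ.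
have np z : (x <= z)%O -> (z <= y)%O -> forall i, z <> p i.
  move=> xz zy i zi; have := nZ z xz zy.
  by rewrite mem_cat negb_or => /andP[/negP + _]; apply; rewrite zi; exact: codom_f.
have ne z : (x <= z)%O -> (z <= y)%O -> forall i, (e i).1 <> Fin z /\ (e i).2 <> Fin z.
  move=> xz zy i; have := nZ z xz zy.
  rewrite mem_cat negb_or => /andP[_ /negP H]; split=> ei; apply: H;
  apply/flatten_mapP; exists i; rewrite ?mem_enum // ei mem_cat inE eqxx //= orbT //.
have xx := lexx x; have yy := lexx y; have lxy := ltW xy.
have -> : B x <-> exists i, oint (e i).1 (e i).2 x.
  by rewrite eB; split=> [[[i _ pE]|[i _ ?]]|[i ?]];
    [case: (np _ xx lxy i)|exists i|right; exists i].
have -> : B y <-> exists i, oint (e i).1 (e i).2 y.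
  by rewrite eB; split=> [[[i _ pE]|[i _ ?]]|[i ?]];
    [case: (np _ lxy yy i)|exists i|right; exists i].
split=> -[i [H1 H2]]; exists i.
  split; first exact: (endpoint_lt_trans H1).
  move: H2; case ei : (e i).2 => [|z|] //= xz; rewrite ltNge; apply/negP => zy.
  by have [_] := ne z (ltW xz) zy i; rewrite ei.
split; last exact: (endpoint_lt_trans _ H2).
move: H1; case ei : (e i).1 => [|z|] //= zy; rewrite ltNge; apply/negP => xz.
by have [] := ne z xz (ltW zy) i; rewrite ei.
Qed.

(** Close enough to the end [e], none of the finitely many points where [B]
may change is met. *)
Lemma germ_ultra s (e : endpoint M) c (B : M -> Prop) : beyond s e c ->
  definable_pred S B -> germ s e B \/ germ s e (fun t => ~ B t).
Proof.
move=> ec /definable_locally_constant [Z BZ].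
have [c' ec' cZ] := germ_notin Z ec.
have [t0 et0 t0c] := beyond_dense ec'.
have Bcst t : beyond s e t -> oriented_lt s t c' -> B t0 <-> B t.
  have between x y : (x < y)%O -> beyond s e x -> oriented_lt s x c' ->
      beyond s e y -> oriented_lt s y c' -> B x <-> B y.
    move=> xy ex xc ey yc; apply: BZ => // z.
    rewrite le_eqVlt => /predU1P[<- _|xz]; first exact: cZ.
    rewrite le_eqVlt => /predU1P[->|zy]; first exact: cZ.
    apply: cZ; move: ex ey xc yc; case: (s) => /= *.
    - exact: (@endpoint_lt_trans _ _ _ (Fin x)).
    - exact: (@endpoint_lt_trans _ _ (Fin z) (Fin y) e).
    - exact: lt_trans zy _.
    - exact: lt_trans xz.
  move=> et tc; case: (ltgtP t0 t) => [lt|lt|-> //]; first exact: between.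
  by apply: iff_sym; exact: between.
have [Bt0|nBt0] := pselect (B t0); [left|right]; exists c' => // t et tc.
  by apply/(Bcst t).
by move=> /(Bcst t et tc).
Qed.

Lemma definable_interval_or_finite (B : M -> Prop) : definable_pred S B ->
  (exists a b, (a < b)%O /\ forall x, (a < x)%O -> (x < b)%O -> B x) \/
  (exists Z : seq M, forall x, B x -> x \in Z).
Proof.
move=> dB; have [Z BZ] := definable_locally_constant dB.
have [[x [Bx xZ]]|H] := pselect (exists x, B x /\ x \notin Z); last first.
  right; exists Z => x Bx; apply: contrapT => /negP nx; apply: H; by exists x.
left; have [y xy] := om_no_max HM x.
have [c /= xc cZ] := @germ_notin true (Fin x) y Z xy.
exists x, c; split=> // t xt tc; apply/(BZ x t xt) => // z.
rewrite le_eqVlt => /predU1P[<- //|xz] zt.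
by apply: cZ => //=; exact: le_lt_trans tc.
Qed.

Lemma seq_min (B : M -> Prop) (Z : seq M) x : (forall y, B y -> y \in Z) -> B x ->
  exists2 m, B m & forall y, B y -> (m <= y)%O.
Proof.
elim: Z B x => [|z Z IH] B x BZ Bx; first by have := BZ _ Bx.
have [[y [By yz]]|H] := pselect (exists y, B y /\ y <> z); last first.
  have Bz y : B y -> y = z by move=> By; apply: contrapT => yz; apply: H; exists y.
  by exists x => // y /Bz ->; rewrite (Bz x).
have [|m [Bm mz] mmin] := IH (fun y => B y /\ y <> z) y _ (conj By yz).
  by move=> t [/BZ]; rewrite inE => /predU1P[].
have [[Bz zm]|nz] := pselect (B z /\ (z < m)%O).
  exists z => // t Bt; have [->//|/eqP tz] := eqVneq t z.
  by apply/ltW/(lt_le_trans zm)/mmin.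
exists m => // t Bt; have [tz|/eqP tz] := eqVneq t z; last exact: mmin.
by rewrite leNgt; apply/negP => tm; apply: nz; rewrite -tz.
Qed.

(** This stands for the completeness of the line, which holds only for
definable sets.  By o-minimality [B] can change only at finitely many points; the
hypotheses exclude a change from true to false at, just after, or just before
each of them, and the interval shrinks past one of them at a time. *)
Lemma definable_induction (B : M -> Prop) (a b : M) : definable_pred S B ->
  (a < b)%O -> B a ->
  (forall x, (a <= x)%O -> (x < b)%O -> B x -> germ true (Fin x) B) ->
  (forall x, (a < x)%O -> (x <= b)%O -> germ false (Fin x) B -> B x) ->
  B b.
Proof.
move=> dB; have [Z] := definable_locally_constant dB.
have PF s x := germ_Fin_proper s x.
move=> BZ ab Ba Br Bl.
have {}BZ x y : (a <= x)%O -> (x < y)%O -> (y <= b)%O ->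
  (forall z, (x <= z)%O -> (z <= y)%O -> z \notin Z) -> B x <-> B y by move=> _ + _; exact: BZ.
elim: Z a b BZ ab Ba Br Bl => [|z Z IH] a b BZ ab Ba Br Bl; first exact/(BZ a b).
have shrink a' b' : (a <= a')%O -> (a' < b')%O -> (b' <= b)%O ->
    ~ ((a' <= z)%O /\ (z <= b')%O) -> B a' -> B b'.
  move=> aa ab' bb nz Ba'; apply: (IH a' b') => // [x y ax xy yb xyZ|x ax xb|x ax xb].
  - apply: BZ (le_trans aa ax) xy (le_trans yb bb) _ => t xt ty.
    rewrite inE negb_or xyZ // andbT; apply/eqP => tz; apply: nz; rewrite -tz.
    by split; [exact: le_trans xt|exact: le_trans yb].
  - by apply: Br; [exact: le_trans ax|exact: lt_le_trans bb].
  - by apply: Bl; [exact: le_lt_trans ax|exact: le_trans bb].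
have [[az zb]|nz] := pselect ((a <= z)%O /\ (z <= b)%O); last exact: (shrink a b).
have [Bz|nBz] := pselect (B z).
  have [<-//|/eqP zb'] := eqVneq z b.
  have ltzb : (z < b)%O by rewrite lt_neqAle zb; apply/andP; split=> //; apply/eqP.
  have zb2 : beyond true (Fin z) b by [].
  have [t [Bt [/= zt tb]]] := filter_ex (filterI (Br z az ltzb Bz) (germ_beyond zb2)).
  apply: (shrink t b) => //; first exact/ltW/(le_lt_trans az).
  by move=> [tz _]; move: (le_lt_trans tz zt); rewrite ltxx.
have ltaz : (a < z)%O.
  by rewrite lt_neqAle az andbT; apply/eqP => e; apply: nBz; rewrite -e.
have za2 : beyond false (Fin z) a by [].
have [H|H] := germ_ultra za2 dB; first by case: nBz; apply: Bl.
have [t [nBt [/= tz at_]]] := filter_ex (filterI H (germ_beyond za2)).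
case: nBt; apply: (shrink a t) => //; first exact: (le_trans (ltW tz)).
by move=> [_ zt]; move: (le_lt_trans zt tz); rewrite ltxx.
Qed.

End OMinimal.

(** * Continuity of definable functions of one variable *)

Section Continuity.
Context (L : language) (d : Order.disp_t) (M : orderTopologicalType d).
Variable S : structure L M.
Hypothesis HM : o_minimal S.

Let M0 : inhabited M := om_inhabited HM.

Lemma definable_oriented_lt (K : Type) {cK : context M K} s (tau rho : K -> M) :
  substitution tau -> substitution rho ->
  definable_pred S (fun x => oriented_lt s (tau x) (rho x)).
Proof. by case: s => st sr; apply: definable_lt. Qed.

Lemma definable_germ (K : Type) {cK : context M K} s (e : K -> endpoint M) (P : K -> M -> Prop) :
  definable_pred S (fun p : K * M => beyond s (e p.1) p.2) ->
  definable_pred S (fun p : K * M => P p.1 p.2) ->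
  definable_pred S (fun x => germ s (e x) (P x)).
Proof.
move=> de dP.
apply: (definable_pred_ext (P := fun x => exists c, beyond s (e x) c /\
  forall t, beyond s (e x) t -> oriented_lt s t c -> P x t)).
  by move=> x; split=> [[c [ec H]]|[c ec H]]; exists c.
apply: (definable_exists M0); apply: definable_and => //=.
apply: (definable_forall M0) => /=; apply: definable_imp.
  by apply: (definable_subst (tau := fun p : K * M * M => (p.1.1, p.2)) _ de); substitution_tac.
apply: definable_imp; first by apply: definable_oriented_lt; substitution_tac.
by apply: (definable_subst (tau := fun p : K * M * M => (p.1.1, p.2)) _ dP); substitution_tac.
Qed.

Lemma definable_germ_Fin (K : Type) {cK : context M K} s (tau : K -> M) (P : K -> M -> Prop) :
  substitution tau -> definable_pred S (fun p : K * M => P p.1 p.2) ->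
  definable_pred S (fun x => germ s (Fin (tau x)) (P x)).
Proof.
move=> st; apply: (definable_germ (e := fun x => Fin (tau x))).
by case: s; apply: definable_lt; substitution_tac.
Qed.

(** Read [r x y] as [h x < h y].  Let [tri c e] say that [c] is the strict
minimum on [[c, e]]; this is a transitive relation.  For fixed [e], the
points [c] with [tri c e] have increasing values, so they are finitely many,
since an interval of them would contradict minimality on the left.  For fixed
[c], call [e] a child of [c] if [tri c e] and no [c'] between them satisfies
[tri c' e].  The children of [c] are finitely many too: in an interval of
children, each point would be related to those just after it.  Hence there is
no child of [c] in [(c, e]] for some [e] close to [c].  But the least [m > c]
with [tri m e] has to be a child of [c]. *)
Lemma no_interval_of_local_minima (r : M -> M -> Prop) (a b : M) :
  definable_pred S (fun p : M * M => r p.1 p.2) ->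
  (forall x, ~ r x x) -> (forall x y z, r x y -> r y z -> r x z) -> (a < b)%O ->
  ~ (forall x, (a < x)%O -> (x < b)%O ->
       germ true (Fin x) (r x) /\ germ false (Fin x) (r x)).
Proof.
move=> dr irr tr ab H.
have PF s x := germ_Fin_proper HM s x.
pose tri c e := [/\ (a < c)%O, (c < e)%O, (e < b)%O &
  forall t, (c < t)%O -> (t <= e)%O -> r c t].
have dtri : definable_pred S (fun p : M * M => tri p.1 p.2).
  apply: (definable_pred_ext (P := fun p : M * M => (a < p.1)%O /\ (p.1 < p.2)%O /\
    (p.2 < b)%O /\ forall t, (p.1 < t)%O -> (t <= p.2)%O -> r p.1 t)).
    by move=> p; split=> [[? [? [? ?]]]|[]].
  definable_tac.
  by apply: (definable_subst (tau := fun p : M * M * M => (p.1.1, p.2)) _ dr); substitution_tac.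
have tri_trans c c' e : tri c c' -> tri c' e -> tri c e.
  move=> [ac cc _ rc] [_ ce eb re]; split=> //; first exact: lt_trans ce.
  move=> t ct te; have [tc|c't] := leP t c'; first exact: rc.
  by apply: tr (re _ c't te); apply: rc.
have tri_sub c e t : tri c e -> (c < t)%O -> (t <= e)%O -> tri c t.
  move=> [ac ce eb rc] ct te; split=> //; first exact: le_lt_trans eb.
  by move=> u cu ut; apply: rc => //; exact: le_trans te.
have tri_near c : (a < c)%O -> (c < b)%O -> germ true (Fin c) (tri c).
  move=> ac cb; have [[e /= ce re] _] := H c ac cb.
  have cb' : beyond true (Fin c) b by [].
  have ce' : beyond true (Fin c) e by [].
  apply: filterS2 (germ_beyond cb') (germ_beyond ce') => t [/= ct tb] [_ te].
  by split=> // u cu ut; apply: re => //; exact: le_lt_trans te.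
have triL_finite e : exists Z : seq M, forall c, tri c e -> c \in Z.
  have de : definable_pred S (fun c => tri c e).
    by apply: (definable_subst (tau := fun c => (c, e)) _ dtri); substitution_tac.
  have [[p [q [pq pqE]]]|//] := definable_interval_or_finite HM de.
  have [x px xq] := om_dense HM pq.
  have [ax xe eb _] := pqE x px xq.
  have [_ Hx] := H x ax (lt_trans xe eb).
  have xp : beyond false (Fin x) p by [].
  have [t [rxt [/= tx pt]]] := filter_ex (filterI Hx (germ_beyond xp)).
  have [_ _ _ rt] := pqE t pt (lt_trans tx xq).
  by case: (irr x); apply: tr rxt _; apply: rt => //; exact: ltW.
pose child c e := tri c e /\ ~ exists c', (c < c')%O /\ tri c' e.
have child_finite c : exists Z : seq M, forall e, child c e -> e \in Z.
  have dc : definable_pred S (fun e => child c e).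
    rewrite /child; definable_tac.
      by apply: (definable_subst (tau := fun e => (c, e)) _ dtri); substitution_tac.
    by apply: (definable_subst (tau := fun p : M * M => (p.2, p.1)) _ dtri); substitution_tac.
  have [[p [q [pq pqE]]]|//] := definable_interval_or_finite HM dc.
  have [x px xq] := om_dense HM pq.
  have [[ac cx xb _] _] := pqE x px xq.
  have xq' : beyond true (Fin x) q by [].
  have [e [txe [/= xe eq]]] := filter_ex (filterI (tri_near x (lt_trans ac cx) xb)
    (germ_beyond xq')).
  have [_ []] := pqE e (lt_trans px xe) eq.
  by exists x.
have [c ac cb] := om_dense HM ab.
have [Z cZ] := child_finite c.
have [e1 /= ce1 te1] := tri_near c ac cb.
have [e2 /= ce2 nZ] := germ_notin HM Z (cb : beyond true (Fin c) b).
have ce1' : beyond true (Fin c) e1 by [].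
have ce2' : beyond true (Fin c) e2 by [].
have [e [[/= ce ee1] [_ ee2]]] := filter_ex (filterI (germ_beyond ce1') (germ_beyond ce2')).
have nchild t : (c < t)%O -> (t <= e)%O -> exists2 c', (c < c')%O & tri c' t.
  move=> ct te; have tct := tri_sub _ _ _ (te1 e ce ee1) ct te.
  apply: contrapT => nex; have /cZ : child c t.
    by split=> // -[c' [cc' tc']]; apply: nex; exists c'.
  by apply/negP; apply: nZ => //; exact: le_lt_trans ee2.
have [c0 cc0 tc0] := nchild e ce (lexx e).
have [Ze Zefin] := triL_finite e.
have [|m [cm tme] mmin] := @seq_min _ _ (fun c' => (c < c')%O /\ tri c' e) Ze c0 _ (conj cc0 tc0).
  by move=> y [_ /Zefin].
have [_ me _ _] := tme.
have [c' cc' tc'm] := nchild m cm (ltW me).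
have := mmin c' (conj cc' (tri_trans _ _ _ tc'm tme)).
by case: tc'm => _ c'm _ _; rewrite leNgt c'm.
Qed.

Lemma locally_increasing (r : M -> M -> Prop) (a b : M) :
  definable_pred S (fun p : M * M => r p.1 p.2) ->
  (forall x y z, r x y -> r y z -> r x z) ->
  (forall x, (a < x)%O -> (x < b)%O ->
     germ true (Fin x) (r x) /\ germ false (Fin x) (r^~ x)) ->
  forall x y, (a < x)%O -> (x < y)%O -> (y < b)%O -> r x y.
Proof.
move=> dr tr H x y ax xy yb.
have PF s z := germ_Fin_proper HM s z.
have [Hx _] := H x ax (lt_trans xy yb).
have xy' : beyond true (Fin x) y by [].
have [x0 [rx0 [/= xx0 x0y]]] := filter_ex (filterI Hx (germ_beyond xy')).
have dB : definable_pred S (r x).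
  by apply: (definable_subst (tau := fun t => (x, t)) _ dr); substitution_tac.
apply: (definable_induction HM dB x0y) => // z.
  move=> x0z zy rxz.
  have [Hz _] := H z (lt_trans ax (lt_le_trans xx0 x0z)) (lt_trans zy yb).
  by apply: filterS Hz => t; exact: tr.
move=> x0z zy rxz.
have [_ Hz] := H z (lt_trans ax (lt_trans xx0 x0z)) (le_lt_trans zy yb).
by have [t [rxt rtz]] := filter_ex (filterI rxz Hz); exact: tr rtz.
Qed.

Definition order_continuous_at (h : M -> M) (x : M) : Prop :=
  forall u v, (u < h x)%O -> (h x < v)%O ->
  exists a b, [/\ (a < x)%O, (x < b)%O &
    forall t, (a < t)%O -> (t < b)%O -> (u < h t)%O /\ (h t < v)%O].

Lemma locally_constant_continuous (h : M -> M) a b x : (a < x)%O -> (x < b)%O ->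
  (forall t, (a < t)%O -> (t < b)%O -> h t = h x) -> order_continuous_at h x.
Proof.
by move=> ax xb H u v uh hv; exists a, b; split=> // t at_ tb; rewrite H.
Qed.

Section Function.
Variable h : M -> M.
Hypothesis dh : definable_pred S (fun p : M * M => h p.1 = p.2).

Lemma definable_comparison s : definable_pred S (fun p : M * M => oriented_lt s (h p.1) (h p.2)).
Proof.
apply: (definable_pred_ext (P := fun p : M * M =>
   exists u v, h p.1 = u /\ h p.2 = v /\ oriented_lt s u v)).
  by move=> p; split=> [[u [v [-> [->]]]]|?] //; exists (h p.1), (h p.2).
apply: (definable_exists M0); apply: (definable_exists M0) => /=.
apply: definable_and; last apply: definable_and.
- by apply: (definable_subst (tau := fun p : M * M * M * M => (p.1.1.1, p.1.2)) _ dh);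
    substitution_tac.
- by apply: (definable_subst (tau := fun p : M * M * M * M => (p.1.1.2, p.2)) _ dh);
    substitution_tac.
- by apply: definable_oriented_lt; substitution_tac.
Qed.

(** The image of [h] is infinite, so it contains an interval; around a value
[y0] in this interval, arbitrarily close values on both sides are attained,
and monotonicity squeezes [h] between them. *)
Lemma strictly_monotone_continuity_point s a b : (a < b)%O ->
  (forall x y, (a < x)%O -> (x < y)%O -> (y < b)%O -> oriented_lt s (h x) (h y)) ->
  exists2 x, (a < x)%O /\ (x < b)%O & order_continuous_at h x.
Proof.
move=> ab mono.
have PF s' z := germ_Fin_proper HM s' z.
have mono' x y : (a < x)%O -> (x < b)%O -> (a < y)%O -> (y < b)%O ->
    oriented_lt s (h x) (h y) -> (x < y)%O.
  move=> ax xb ay yb hxy; have [//|yx|xy] := ltgtP x y.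
    have := oriented_lt_trans hxy (mono y x ay yx xb); by rewrite oriented_lt_irr.
  by move: hxy; rewrite xy oriented_lt_irr.
have dim : definable_pred S (fun y => exists x, ((a < x)%O /\ (x < b)%O) /\ h x = y).
  apply: (definable_exists M0); apply: definable_and; first by definable_tac.
  by apply: (definable_subst (tau := fun p : M * M => (p.2, p.1)) _ dh); substitution_tac.
have [[p [q [pq im]]]|[Z imZ]] := definable_interval_or_finite HM dim; last first.
  exfalso.
  have dhz z : definable_pred S (fun t => h t = z).
    by apply: (definable_subst (tau := fun t => (t, z)) _ dh); substitution_tac.
  have ab' : beyond true (Fin a) b by [].
  have nz z : germ true (Fin a) (fun t => h t <> z).
    have [[c /= ac hz]|//] := germ_ultra HM ab' (dhz z).
    have ac' : beyond true (Fin a) c by [].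
    have [t [[/= at_ tb] [_ tc]]] := filter_ex (filterI (germ_beyond ab') (germ_beyond ac')).
    have [u au ut] := om_dense HM at_.
    have := mono u t au ut tb.
    by rewrite (hz t) // (hz u) // ?oriented_lt_irr //; exact: lt_trans tc.
  have : germ true (Fin a) (fun t => h t \notin Z).
    elim: (Z) => [|z Z' IH]; first by apply: filterS (nz a).
    by apply: filterS2 (nz z) IH => t /eqP tz tZ; rewrite inE negb_or tz.
  move=> /(filterI (germ_beyond ab')) /filter_ex[t [[/= at_ tb]]].
  by rewrite imZ //; exists t.
have [y0 py0 y0q] := om_dense HM pq.
have [x0 [[ax0 x0b] hx0]] := im y0 py0 y0q.
exists x0 => // u v; rewrite hx0 => uy yv.
have [y1 y1u] : exists2 y1, (Order.max u p < y1)%O & (y1 < y0)%O.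
  by apply: (om_dense HM); rewrite gt_max uy.
have [y2 y2v] : exists2 y2, (y0 < y2)%O & (y2 < Order.min v q)%O.
  by apply: (om_dense HM); rewrite lt_min yv.
rewrite lt_min => /andP[y2v' y2q] y1y0.
move: y1u; rewrite gt_max => /andP[uy1 py1].
have [x1 [[ax1 x1b] hx1]] := im y1 py1 (lt_trans y1y0 y0q).
have [x2 [[ax2 x2b] hx2]] := im y2 (lt_trans py0 y2v) y2q.
move: mono mono'; case: (s) => mono mono'.
  exists x1, x2; split;
    [by apply: mono' => //=; rewrite hx1 hx0|by apply: mono' => //=; rewrite hx2 hx0|].
  move=> t x1t tx2; split.
    by apply: lt_trans uy1 _; rewrite -hx1; apply: mono => //; exact: lt_trans x2b.
  by apply: lt_trans y2v'; rewrite -hx2; apply: mono => //; exact: lt_trans x1t.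
exists x2, x1; split;
  [by apply: mono' => //=; rewrite hx2 hx0|by apply: mono' => //=; rewrite hx1 hx0|].
move=> t x2t tx1; split.
  by apply: lt_trans uy1 _; rewrite -hx1; apply: mono => //; exact: lt_trans x2t.
by apply: lt_trans y2v'; rewrite -hx2; apply: mono => //; exact: lt_trans x1b.
Qed.

Lemma oriented_ltC s (x y : M) : oriented_lt (~~ s) x y = oriented_lt s y x.
Proof. by case: s. Qed.

Lemma interval_alternative (P1 P2 : M -> Prop) a b : (a < b)%O -> definable_pred S P1 ->
  (forall x, (a < x)%O -> (x < b)%O -> P1 x \/ P2 x) ->
  exists a' b', [/\ (a <= a')%O, (b' <= b)%O, (a' < b')%O &
    (forall x, (a' < x)%O -> (x < b')%O -> P1 x) \/
    (forall x, (a' < x)%O -> (x < b')%O -> P2 x)].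
Proof.
move=> ab dP1 P12.
have ab' : beyond true (Fin a) b by [].
have PF := germ_Fin_proper HM true a.
have [HP|HP] := germ_ultra HM ab' dP1.
  have [c /= ac H] := filterI (germ_beyond ab') HP.
  have [b' ab1 b'c] := om_dense HM ac.
  have [[_ b'b] _] := H b' ab1 b'c.
  exists a, b'; split=> //; [exact: ltW|left=> x ax xb].
  by have [] := H x ax (lt_trans xb b'c).
have [c /= ac H] := filterI (germ_beyond ab') HP.
have [b' ab1 b'c] := om_dense HM ac.
have [[_ b'b] _] := H b' ab1 b'c.
exists a, b'; split=> //; [exact: ltW|right=> x ax xb].
have [_ nP1] := H x ax (lt_trans xb b'c).
by have [//|] := P12 x ax (lt_trans xb b'b).
Qed.

(** On each side of each point, [h] is eventually smaller, equal or larger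
than its value at this point.  Equality on one side gives a continuity point
at once.  Otherwise the two one-sided types are constant on a subinterval:
equal types make every point a strict local extremum, which is impossible,
and opposite types make [h] strictly monotone. *)
Lemma continuity_point a b : (a < b)%O ->
  exists2 x, (a < x)%O /\ (x < b)%O & order_continuous_at h x.
Proof.
move=> ab; apply: contrapT => ncont.
have PF s' z := germ_Fin_proper HM s' z.
have dr := definable_comparison.
have dright s : definable_pred S (fun x => germ s (Fin x) (fun t => oriented_lt true (h x) (h t))).
  by apply: definable_germ_Fin; [substitution_tac|exact: dr].
have types s x : (a < x)%O -> (x < b)%O ->
    germ s (Fin x) (fun t => oriented_lt true (h x) (h t)) \/
    germ s (Fin x) (fun t => oriented_lt false (h x) (h t)).
  move=> ax xb; have [y xy] := oriented_no_max HM s x.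
  have xy' : beyond s (Fin x) y by rewrite beyond_Fin.
  have dx s' : definable_pred S (fun t => oriented_lt s' (h x) (h t)).
    by apply: (definable_subst (tau := fun t => (x, t)) _ (dr s')); substitution_tac.
  have [|H1] := germ_ultra HM xy' (dx true); first by left.
  have [|H2] := germ_ultra HM xy' (dx false); first by right.
  case: ncont.
  have : germ s (Fin x) (fun t => h t = h x).
    by apply: filterS2 H1 H2 => t /= /negP + /negP; case: ltgtP.
  pose z := if s then b else a.
  have xz : beyond s (Fin x) z by rewrite /z; case: (s).
  move=> /(filterI (germ_beyond xz)) [c xc hc].
  have [t xt tc] := beyond_dense HM xc.
  have [[_ tz] htx] := hc t xt tc.
  have htc u : oriented_lt s x u -> oriented_lt s u c -> h u = h t.
    by rewrite htx => xu uc; have [|_] := hc u _ uc; rewrite ?beyond_Fin.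
  exists t; move: xz tz xt tc htc; rewrite /z; case: (s) => //= _ tz xt tc htc.
  - by split=> //; exact: lt_trans xt.
  - by split=> //; exact: lt_trans xb.
  - exact: (locally_constant_continuous xt tc).
  - by apply: (locally_constant_continuous tc xt) => u *; exact: htc.
have [a1 [b1 [aa1 b1b ab1 H1]]] := interval_alternative ab (dright true) (types true).
have types1 x : (a1 < x)%O -> (x < b1)%O -> _ \/ _ :=
  fun ax xb => types false x (le_lt_trans aa1 ax) (lt_le_trans xb b1b).
have [a2 [b2 [aa2 b2b ab2 H2]]] := interval_alternative ab1 (dright false) types1.
have [s1 {}H1] : exists s1, forall x, (a2 < x)%O -> (x < b2)%O ->
    germ true (Fin x) (fun t => oriented_lt s1 (h x) (h t)).
  by case: H1 => H1; [exists true|exists false] => x ax xb; apply: H1;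
    [exact: le_lt_trans ax|exact: lt_le_trans b2b|exact: le_lt_trans ax|exact: lt_le_trans b2b].
have [s2 {}H2] : exists s2, forall x, (a2 < x)%O -> (x < b2)%O ->
    germ false (Fin x) (fun t => oriented_lt s2 (h x) (h t)).
  by case: H2 => H2; [exists true|exists false].
have [e12|/negbTE ne12] := boolP (s1 == s2).
  apply: (no_interval_of_local_minima (r := fun x y => oriented_lt s1 (h x) (h y))
    (dr s1) _ _ ab2) => [x /=|x y z /=|x ax xb].
  - by rewrite oriented_lt_irr.
  - exact: oriented_lt_trans.
  - by split; [exact: H1|rewrite (eqP e12); exact: H2].
have s2E : s2 = ~~ s1 by move: ne12; case: (s1) (s2) => -[].
have mono := locally_increasing (r := fun x y => oriented_lt s1 (h x) (h y)) (a := a2) (b := b2).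
have [|x [ax xb] cx] := @strictly_monotone_continuity_point s1 _ _ ab2.
  apply: mono => [|x y z|x ax xb]; [exact: dr|exact: oriented_lt_trans|].
  split; first exact: H1.
  by apply: filterS (H2 x ax xb) => t; rewrite s2E oriented_ltC.
apply: ncont; exists x => //; split.
  by apply: le_lt_trans ax; exact: le_trans aa2.
by apply: lt_le_trans xb _; exact: le_trans b1b.
Qed.

(** The set of continuity points is definable, and its complement contains no
interval. *)
Lemma eventually_continuous s e c : beyond s e c -> germ s e (order_continuous_at h).
Proof.
move=> ec.
have dcont : definable_pred S (order_continuous_at h).
  apply: (definable_pred_ext (P := fun x => exists y, h x = y /\
    forall u v, (u < y)%O -> (y < v)%O -> exists a b, (a < x)%O /\ (x < b)%O /\
      forall t, (a < t)%O -> (t < b)%O -> exists z, h t = z /\ (u < z)%O /\ (z < v)%O)).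
    move=> x; split=> [[y [<- H]] u v uh hv|H].
      have [a [b [ax [xb ab]]]] := H u v uh hv.
      by exists a, b; split=> // t at_ tb; have [z [-> []]] := ab t at_ tb.
    exists (h x); split=> // u v uh hv; have [a [b [ax xb ab]]] := H u v uh hv.
    exists a, b; split=> //; split=> // t at_ tb; exists (h t); split=> //.
    exact: ab.
  definable_tac.
  by apply: (definable_subst
    (tau := fun p : M * M * M * M * M * M * M * M => (p.1.2, p.2)) _ dh); substitution_tac.
have [//|[c' ec' nc]] := germ_ultra HM ec dcont.
have [t et tc] := beyond_dense HM ec'.
have [u tu uc] := oriented_dense HM tc.
exfalso; move: nc et tc tu uc; case: (s) => /= nc et tc tu uc.
  have [x [tx xu]] := continuity_point tu; apply: nc; last exact: lt_trans uc.
  exact: (@endpoint_lt_trans _ _ e (Fin t) (Fin x)).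
have [x [ux xt]] := continuity_point tu; apply: nc; last exact: lt_trans ux.
exact: (@endpoint_lt_trans _ _ (Fin x) (Fin t) e).
Qed.

End Function.
End Continuity.

(** * Boxes, charts and definable families of points *)

Section Charts.
Context (L : language) (d : Order.disp_t) (M : orderTopologicalType d).
Variable S : structure L M.
Hypothesis HM : o_minimal S.

Let M0 : inhabited M := om_inhabited HM.

Lemma nbhs_intervalP (x : M) (A : set M) : nbhs x A <->
  exists a b, [/\ (a < x)%O, (x < b)%O & forall t, (a < t)%O -> (t < b)%O -> A t].
Proof.
have [a0 a0x] := om_no_min HM x; have [b0 xb0] := om_no_max HM x.
split=> [|[a [b [ax xb abA]]]]; last first.
  have : nbhs x `]a, b[%classic.
    by apply: open_nbhs_nbhs; split; [exact: itv_open|rewrite /= in_itv /= ax xb].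
  by apply: filterS => t /=; rewrite in_itv => /andP[]; exact: abA.
rewrite itv_nbhsE => -[[l r] [lr xlr] lrA].
pose a := if l is BSide _ a then a else a0; pose b := if r is BSide _ b then b else b0.
move: lr xlr lrA; rewrite /itv_open_ends /itv_is_open_unbounded /itv_is_oo.
case: l r @a @b => [[] a1|[]] [[] b1|[]] //= _; rewrite in_itv /= ?andbT.
- move=> /andP[ax xb] abA; exists a1, b1; split=> // t at_ tb.
  by apply: abA; rewrite /= in_itv /= at_ tb.
- move=> ax abA; exists a1, b0; split=> // t at_ tb.
  by apply: abA; rewrite /= in_itv /= at_.
- move=> xb abA; exists a0, b1; split=> // t at_ tb.
  by apply: abA; rewrite /= in_itv /= tb.
- move=> _ abA; exists a0, b0; split=> // t at_ tb.
  by apply: abA.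
Qed.

Lemma order_continuousE (h : M -> M) x : order_continuous_at h x ->
  {for x, continuous h}.
Proof.
move=> hx A /nbhs_intervalP[u [v [uh hv uvA]]].
have [a [b [ax xb ab]]] := hx u v uh hv.
apply/nbhs_intervalP; exists a, b; split=> // t at_ tb.
by have [] := ab t at_ tb; exact: uvA.
Qed.

Definition in_box n (p q z : 'rV[M]_n) : Prop :=
  forall k, (p ord0 k < z ord0 k)%O /\ (z ord0 k < q ord0 k)%O.

Lemma definable_in_box (K : Type) {cK : context M K} n (p q z : K -> 'rV[M]_n) :
  substitution p -> substitution q -> substitution z ->
  definable_pred S (fun x => in_box (p x) (q x) (z x)).
Proof. by move=> sp sq sz; rewrite /in_box; definable_tac. Qed.

Lemma nbhs_boxP n (z : 'rV[M]_n) (A : set 'rV[M]_n) : nbhs z A <->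
  exists p q, in_box p q z /\ forall z', in_box p q z' -> A z'.
Proof.
split=> [[P zP PA]|[p [q [zpq pqA]]]].
  have /choice[ab abP] k : exists ab : M * M, [/\ (ab.1 < z ord0 k)%O, (z ord0 k < ab.2)%O &
      forall t, (ab.1 < t)%O -> (t < ab.2)%O -> P ord0 k t].
    by have /nbhs_intervalP[a [b [az zb abP]]] := zP ord0 k; exists (a, b).
  exists (\row_k (ab k).1)%R, (\row_k (ab k).2)%R.
  split=> [k|z' z'in]; first by rewrite !mxE; have [] := abP k.
  apply: PA => i k; rewrite ord1.
  by have [_ _] := abP k; apply; have := z'in k; rewrite !mxE => -[].
exists (fun i k t => (p ord0 k < t)%O /\ (t < q ord0 k)%O) => [i k|z' z'in].
  apply/nbhs_intervalP; exists (p ord0 k), (q ord0 k); rewrite (ord1 i).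
  by have [pz zq] := zpq k; split.
by apply: pqA => k; exact: z'in.
Qed.

Section Space.
Variable X : definable_space S.
Implicit Type i : 'I_(nb_charts X).

Lemma nbhs_chartP i (x : X) (A : set X) : chart_dom i x -> nbhs x A <->
  exists p q, in_box p q (chart i x) /\
    forall x', chart_dom i x' -> in_box p q (chart i x') -> A x'.
Proof.
move=> Dx; split=> [|[p [q [xpq pqA]]]].
  rewrite nbhsE => -[U [oU Ux] UA].
  have oUD : open (U `&` chart_dom i) by apply: openI => //; exact: open_chart_dom.
  have [V oV eV] := (open_chartE (@subIsetr _ U (chart_dom i))).1 oUD.
  have Vx : V (chart i x).
    have : (chart i @` (U `&` chart_dom i)) (chart i x) by exists x.
    by rewrite eV => -[].
  have /nbhs_boxP[p [q [xpq pqV]]] : nbhs (chart i x) V by apply: open_nbhs_nbhs.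
  exists p, q; split=> // x' Dx' x'pq; apply: UA.
  have : (chart i @` (U `&` chart_dom i)) (chart i x').
    by rewrite eV; split; [exists x'|exact: pqV].
  by move=> [y [Uy Dy] /(chart_inj Dy Dx') <-].
pose U := [set x' | chart_dom i x' /\ in_box p q (chart i x')].
have oU : open U.
  apply/(@open_chartE _ _ _ _ _ i) => [x' []//|].
  exists [set z | in_box p q z].
    rewrite openE => z zpq; apply/nbhs_boxP; by exists p, q.
  by apply/seteqP; split=> [_ [x' [? ?] <-]|_ [[x' ? <-] ?]]; [split=> //; exists x'|exists x'].
have : nbhs x U by apply: open_nbhs_nbhs.
by apply: filterS => x' []; exact: pqA.
Qed.

Lemma in_some_chart (x : X) : exists i, chart_dom i x.
Proof. by have : [set: X] x by []; rewrite -(chart_cover X) => -[i _]; exists i. Qed.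

Section Family.
Context (K : Type) {cK : context M K}.
Implicit Type c : K -> X.

(** Definability of a function from a context to a definable space is read in
every chart, since a space has no global coordinates. *)
Definition definable_family c : Prop := forall i,
  definable_pred S (fun p : K * 'rV[M]_(chart_dim i) =>
    chart_dom i (c p.1) /\ chart i (c p.1) = p.2).

Lemma definable_family_pred c i (Q : K -> 'rV[M]_(chart_dim i) -> Prop) :
  definable_family c ->
  definable_pred S (fun p : K * 'rV[M]_(chart_dim i) => Q p.1 p.2) ->
  definable_pred S (fun x => chart_dom i (c x) /\ Q x (chart i (c x))).
Proof.
move=> dc dQ.
apply: (definable_pred_ext (P := fun x => exists z,
  (chart_dom i (c x) /\ chart i (c x) = z) /\ Q x z)).
  by move=> x; split=> [[z [[? <-]]]|[]]; [|exists (chart i (c x))].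
by apply: (definable_exists_row M0); apply: definable_and; [exact: dc|].
Qed.

Lemma definable_family_dom c i : definable_family c ->
  definable_pred S (fun x => chart_dom i (c x)).
Proof.
move=> dc.
have dT := definable_family_pred (i := i) (Q := fun _ _ => True) dc (definable_cst _ M0 _).
by apply: definable_pred_ext dT => x; split=> [[]|].
Qed.

Lemma definable_family_mem c (A : set X) : definable_subset A -> definable_family c ->
  definable_pred S (fun x => A (c x)).
Proof.
move=> dA dc.
apply: (definable_pred_ext (P := fun x => exists i,
    chart_dom i (c x) /\ (chart i @` (A `&` chart_dom i)) (chart i (c x)))).
  move=> x; split=> [[i [Dc [y [Ay Dy] /(chart_inj Dy Dc) <-]]] //|Ac].
  by have [i Di] := in_some_chart (c x); exists i; split=> //; exists (c x).
apply: (definable_exists_finite M0) => i.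
apply: (definable_family_pred (Q := fun _ z => (chart i @` (A `&` chart_dom i)) z)) => //.
by apply: (definable_mem (dA i)); substitution_tac.
Qed.

End Family.

Lemma definable_family_subst (K K' : Type) {cK : context M K} {cK' : context M K'}
    (tau : K -> K') (c : K' -> X) :
  substitution tau -> definable_family c -> definable_family (fun x => c (tau x)).
Proof.
move=> st dc i.
apply: (definable_subst (tau := fun p : K * 'rV_(chart_dim i) => (tau p.1, p.2)) _ (dc i)).
substitution_tac.
Qed.

Lemma definable_family_graph (Q : M -> Prop) (g : M -> X) i :
  definable_pred S Q -> definable_family g ->
  definable_graph S ([set t | Q t] `&` g @^-1` chart_dom i)
    (fun t => const_mx t : 'rV[M]_1) (chart i \o g).
Proof.
move=> dQ dg; apply/(definable_predP _ M0).
apply: (definable_pred_ext (P := fun w : 'rV[M]_(1 + chart_dim i) => exists t,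
   Q t /\ (chart_dom i (g t) /\ chart i (g t) = rsubmx w) /\ lsubmx w = const_mx t)).
  move=> w; split=> [[t [Qt [[Dt wr] wl]]]|[t [Qt Dt] <-]].
    by exists t => //=; rewrite wr -wl hsubmxK.
  by exists t; rewrite row_mxKl row_mxKr.
apply: (definable_exists M0); apply: definable_and => /=.
  by apply: (definable_subst _ dQ); substitution_tac.
apply: definable_and; last by definable_tac.
apply: (definable_subst
  (tau := fun p : 'rV[M]_(1 + chart_dim i) * M => (p.2, rsubmx p.1)) _ (dg i)).
by substitution_tac.
Qed.

End Space.

Lemma definable_family_comp (X Y : definable_space S) (f : X -> Y) (K : Type)
    {cK : context M K} (c : K -> X) :
  definable_map f -> definable_family c -> definable_family (fun x => f (c x)).
Proof.
move=> df dc j.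
apply: (definable_pred_ext (P := fun p : K * 'rV_(chart_dim j) => exists i : 'I_(nb_charts X),
    chart_dom i (c p.1) /\ [set row_mx (chart i x) (chart j (f x)) |
      x in chart_dom i `&` f @^-1` chart_dom j] (row_mx (chart i (c p.1)) p.2))).
  move=> p; split=> [[i [Di [x [Dx Dfx] /eq_row_mx[]]]]|[Dj <-]].
    by move=> /(chart_inj Dx Di) <-.
  by have [i Di] := in_some_chart (c p.1); exists i; split=> //; exists (c p.1).
apply: (definable_exists_finite M0) => i.
apply: (definable_family_pred (Q := fun p z => [set row_mx (chart i x) (chart j (f x)) |
      x in chart_dom i `&` f @^-1` chart_dom j] (row_mx z p.2))).
  by apply: definable_family_subst dc; substitution_tac.
by apply: (definable_mem (df i j)); substitution_tac.
Qed.

End Charts.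

(** * Definable curves and their limits *)

Lemma filter_forall_ord (T : Type) (F : set_system T) {FF : Filter F} n
    (P : 'I_n -> T -> Prop) :
  (forall i, F (P i)) -> F (fun t => forall i, P i t).
Proof. exact: (@filter_forall T 'I_n P F FF). Qed.

Section Curves.
Context (L : language) (d : Order.disp_t) (M : orderTopologicalType d).
Variable S : structure L M.
Hypothesis HM : o_minimal S.

Let M0 : inhabited M := om_inhabited HM.

Lemma definable_beyond (K : Type) {cK : context M K} s (e : endpoint M) (tau : K -> M) :
  substitution tau -> definable_pred S (fun x => beyond s e (tau x)).
Proof.
by move=> st; case: s e => -[|y|] /=; try (by apply: (definable_cst _ M0));
  apply: definable_lt; substitution_tac.
Qed.

Lemma definable_oint (K : Type) {cK : context M K} (a b : endpoint M) (tau : K -> M) :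
  substitution tau -> definable_pred S (fun x => oint a b (tau x)).
Proof.
move=> st; apply: definable_and; first exact: (definable_beyond true).
exact: (definable_beyond false).
Qed.

Lemma open_oint (a b : endpoint M) : open (oint a b).
Proof.
rewrite openE => t [at_ tb]; apply/(nbhs_intervalP HM).
have [u [ut ua]] : exists u, (u < t)%O /\ forall t', (u < t')%O -> endpoint_lt a (Fin t').
  case: a at_ => [|y|] //= yt; last by exists y.
  by have [u ut] := om_no_min HM t; exists u.
have [v [tv vb]] : exists v, (t < v)%O /\ forall t', (t' < v)%O -> endpoint_lt (Fin t') b.
  case: b tb => [|y|] //= ty; first by exists y.
  by have [v tv] := om_no_max HM t; exists v.
by exists u, v; split=> // t' ut' t'v; split; [exact: ua|exact: vb].
Qed.

Lemma oint_nonempty (a b : endpoint M) : endpoint_lt a b -> exists t, oint a b t.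
Proof.
case: a b => [|x|] [|y|] //= ab.
- by have [t ty] := om_no_min HM y; exists t.
- by case: M0 => t; exists t.
- by have [t xt ty] := om_dense HM ab; exists t.
- by have [t xt] := om_no_max HM x; exists t.
Qed.

Definition germ_itv s (e : endpoint M) (c : M) : endpoint M * endpoint M :=
  if s then (e, Fin c) else (Fin c, e).

Lemma germ_itvP s e c t :
  oint (germ_itv s e c).1 (germ_itv s e c).2 t <-> beyond s e t /\ oriented_lt s t c.
Proof. by case: s; split=> -[? ?]. Qed.

Section Space.
Variable X : definable_space S.

Lemma family_definable_curve (C : set X) a b (g : M -> X) : endpoint_lt a b ->
  definable_family g -> (forall t, oint a b t -> C (g t)) ->
  (forall t, oint a b t -> {for t, continuous g}) -> definable_curve C a b g.
Proof.
move=> ab dg Cg cg; split=> //; first by move=> _ [t /Cg ? <-].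
  rewrite continuous_open_subspace; last exact: open_oint.
  by move=> t; rewrite inE => /cg.
move=> j; apply: (definable_family_graph HM) => //.
by apply: definable_oint; substitution_tac.
Qed.

(** Extending a curve by a constant value outside its interval makes it
a definable family indexed by the whole line. *)
Lemma definable_curve_family (C : set X) a b (alpha : M -> X) :
  definable_curve C a b alpha ->
  exists g : M -> X, [/\ definable_family g, forall t, C (g t),
    forall t, oint a b t -> g t = alpha t &
    forall t, oint a b t -> {for t, continuous g}].
Proof.
move=> [ab Ca]; rewrite continuous_open_subspace; last exact: open_oint.
move=> ca da; have [t0 t0ab] := oint_nonempty ab.
pose g t := if `[< oint a b t >] then alpha t else alpha t0.
have gE t : oint a b t -> g t = alpha t by rewrite /g; case: asboolP.
exists g; split=> // [i|t|t abt].
- apply: (definable_pred_ext (P := fun p : M * 'rV_(chart_dim i) =>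
    (oint a b p.1 /\ [set row_mx (const_mx t : 'rV[M]_1) ((chart i \o alpha) t) |
       t in oint a b `&` alpha @^-1` chart_dom i] (row_mx (const_mx p.1) p.2)) \/
    (~ oint a b p.1 /\ chart_dom i (alpha t0) /\ chart i (alpha t0) = p.2))).
    move=> p; rewrite /g; case: asboolP => abp; split.
    + move=> [[_ [t [abt Dt] /eq_row_mx[/rowP/(_ ord0)]]]|[]//].
      by rewrite !mxE => <-.
    + by move=> [Dp pE]; left; split=> //; exists p.1 => //=; rewrite pE.
    + by case=> -[].
    + by move=> [? ?]; right.
  apply: definable_or; apply: definable_and.
  + by apply: definable_oint; substitution_tac.
  + by apply: (definable_mem (da i)); substitution_tac.
  + by apply: definable_not; apply: definable_oint; substitution_tac.
  + by apply: definable_and; [exact: definable_cst|definable_tac].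
- by apply: Ca; rewrite /g; case: asboolP => ?; [exists t|exists t0].
- have cat : {for t, continuous alpha} by apply: ca; rewrite inE.
  move=> A; rewrite gE // => /cat; rewrite /nbhs /= => At.
  have abN : nbhs t (oint a b) by apply: open_nbhs_nbhs; split=> //; exact: open_oint.
  by apply: filterS2 abN At => u abu; rewrite /= gE.
Qed.

Lemma germ_in_chart (g : M -> X) s e c : definable_family g -> beyond s e c ->
  exists i, germ s e (fun t => chart_dom i (g t)).
Proof.
move=> dg ec; have PF := germ_proper HM ec.
apply: contrapT => nex.
have : germ s e (fun t => forall i, ~ chart_dom i (g t)).
  apply: filter_forall_ord => i.
  have [H|//] := germ_ultra HM ec (definable_family_dom HM i dg).
  by case: nex; exists i.
by move=> /filter_ex[t nt]; have [i /nt] := in_some_chart (g t).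
Qed.

(** The point [g t] stays in one chart near the end, by o-minimality, and each of
its coordinates there is eventually continuous. *)
Lemma family_eventually_continuous (g : M -> X) s e c : definable_family g -> beyond s e c ->
  germ s e (fun t => {for t, continuous g}).
Proof.
move=> dg ec; have PF := germ_proper HM ec; have [a0] := M0.
have [i gi] := germ_in_chart dg ec.
(* The default value a0 is used only away from the chart. *)
pose h l t := if `[< chart_dom i (g t) >] then chart i (g t) ord0 l else a0.
have dh l : definable_pred S (fun p : M * M => h l p.1 = p.2).
  apply: (definable_pred_ext (P := fun p : M * M =>
    (chart_dom i (g p.1) /\ chart i (g p.1) ord0 l = p.2) \/
    (~ chart_dom i (g p.1) /\ a0 = p.2))).
    move=> p; rewrite /h; case: asboolP => Dp; split=> [[[]|[]]|] //; first by left.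
    by right.
  have dg1 : definable_family (fun p : M * M => g p.1).
    by apply: definable_family_subst dg; substitution_tac.
  apply: definable_or.
    apply: (definable_family_pred HM (Q := fun p z => z ord0 l = p.2)) => //.
    by definable_tac.
  apply: definable_and; last by definable_tac.
  by apply: definable_not; exact: definable_family_dom.
have hc : germ s e (fun t => forall l, order_continuous_at (h l) t).
  apply: filter_forall_ord => l.
  exact: (eventually_continuous HM (dh l) ec).
have [c' ec' H] := filterI gi hc.
exists c' => // t et tc A.
have W : nbhs t (fun u => chart_dom i (g u)).
  have : nbhs t (oint (germ_itv s e c').1 (germ_itv s e c').2).
    by apply: open_nbhs_nbhs; split; [exact: open_oint|apply/germ_itvP].
  by apply: filterS => u /germ_itvP[eu uc]; have [] := H u eu uc.
have [Dt ht] := H t et tc.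
move=> /(nbhs_chartP HM _ Dt)[p [q [tpq pqA]]].
have box : nbhs t (fun u => forall l, (p ord0 l < h l u)%O /\ (h l u < q ord0 l)%O).
  apply: filter_forall_ord => l.
  apply: (@order_continuousE _ _ _ _ HM _ _ (ht l) (fun y => (p ord0 l < y)%O /\ (y < q ord0 l)%O)).
  apply/(nbhs_intervalP HM); exists (p ord0 l), (q ord0 l).
  by rewrite /h asboolT //; have [? ?] := tpq l; split.
rewrite /nbhs /=; apply: filterS2 W box => u Du hu.
by apply: pqA => // l; have := hu l; rewrite /h asboolT.
Qed.

Lemma family_limit (C : set X) (g : M -> X) s e c : definably_compact C ->
  definable_family g -> beyond s e c -> germ s e (fun t => C (g t)) ->
  exists2 x, C x & g @ germ s e --> x.
Proof.
move=> Cc dg ec Cg; have PF := germ_proper HM ec.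
have [c' ec' H] := filterI Cg (family_eventually_continuous dg ec).
have lohi : endpoint_lt (germ_itv s e c').1 (germ_itv s e c').2 by move: ec'; case: (s).
have /Cc : definable_curve C (germ_itv s e c').1 (germ_itv s e c').2 g.
  by apply: family_definable_curve => // t /germ_itvP[et /(H t et)[]].
by rewrite germE; case: (s) => -[] /=.
Qed.

(** A definable box around [x] is eventually entered for good or left for
good, so a family that does not tend to [x] avoids some box. *)
Lemma family_escape (g : M -> X) s e c (x : X) : definable_family g -> beyond s e c ->
  ~ (g @ germ s e --> x) -> exists2 N, nbhs x N & germ s e (fun t => ~ N (g t)).
Proof.
move=> dg ec ncvg; have PF := germ_proper HM ec.
have [i Dx] := in_some_chart x.
apply: contrapT => nex; apply: ncvg => A /(nbhs_chartP HM _ Dx)[p [q [xpq pqA]]].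
have dpq : definable_pred S (fun t => chart_dom i (g t) /\ in_box p q (chart i (g t))).
  apply: (definable_family_pred HM (Q := fun _ z => in_box p q z)) => //.
  by apply: (definable_in_box HM); substitution_tac.
have [H|H] := germ_ultra HM ec dpq.
  by apply: filterS H => t [Dt /(pqA _ Dt)].
case: nex; exists (fun y => chart_dom i y /\ in_box p q (chart i y)) => //.
by apply/(nbhs_chartP HM _ Dx); exists p, q.
Qed.

(** Definable induction along the segment: a neighborhood that avoids
[g] on [[a, s]] can be shrunk to avoid it a little further, by continuity at
[s] and separation of [g s] from [x]. *)
Lemma nbhs_avoiding_segment (g : M -> X) a b (x : X) : hausdorff_space X ->
  definable_family g -> (a <= b)%O ->
  (forall t, (a <= t)%O -> (t <= b)%O -> {for t, continuous g}) ->
  (forall t, (a <= t)%O -> (t <= b)%O -> g t <> x) ->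
  nbhs x (fun y => forall t, (a <= t)%O -> (t <= b)%O -> g t <> y).
Proof.
move=> HX dg ab cg gx.
have PF s z := germ_Fin_proper HM s z.
have local t : (a <= t)%O -> (t <= b)%O -> exists u v, [/\ (u < t)%O, (t < v)%O &
    nbhs x (fun y => forall t', (u < t')%O -> (t' < v)%O -> g t' <> y)].
  move=> at_ tb; move: HX; rewrite open_hausdorff => HX'.
  have /HX'[[U V] /= [xU gV] [oU oV /eqP UV]] : x != g t.
    by apply/eqP => e; apply: (gx t).
  have /(cg t at_ tb)/(nbhs_intervalP HM)[u [v [ut tv uvV]]] : nbhs (g t) V.
    by apply: open_nbhs_nbhs; rewrite inE in gV.
  exists u, v; split=> //.
  have : nbhs x U by apply: open_nbhs_nbhs; rewrite inE in xU.
  apply: filterS => y Uy t' ut' t'v e.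
  have : (U `&` V) y by split=> //; rewrite -e; exact: uvV.
  by rewrite UV.
(* The neighborhoods in B s may be taken to be boxes in a chart, and this
   makes B definable. *)
pose B s := nbhs x (fun y => forall t, (a <= t)%O -> (t <= s)%O -> g t <> y).
have Ba : B a.
  have [u [v [ua av]]] := local a (lexx a) ab.
  by apply: filterS => y H t at_ ta; apply: H; [exact: lt_le_trans at_|exact: le_lt_trans av].
move: ab; rewrite le_eqVlt => /predU1P[<- //|ab].
have [i Dx] := in_some_chart x.
have dB : definable_pred S B.
  apply: (definable_pred_ext (P := fun s => exists p q, in_box p q (chart i x) /\
    forall t, (a <= t)%O -> (t <= s)%O -> ~ (chart_dom i (g t) /\ in_box p q (chart i (g t))))).
    move=> s; apply: iff_sym; apply: (iff_trans (nbhs_chartP HM _ Dx)).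
    split=> -[p [q [xpq H]]]; exists p, q; split=> //.
      by move=> t at_ ts [Dt tpq]; apply: (H _ Dt tpq t).
    by move=> y Dy ypq t at_ ts e; apply: (H t at_ ts); rewrite e.
  have dleaf : definable_pred S (fun w : M * 'rV_(chart_dim i) * 'rV_(chart_dim i) * M =>
      chart_dom i (g w.2) /\ in_box w.1.1.2 w.1.2 (chart i (g w.2))).
    apply: (definable_family_pred HM (c := fun w => g w.2)
      (Q := fun (w : M * 'rV_(chart_dim i) * 'rV_(chart_dim i) * M) z => in_box w.1.1.2 w.1.2 z)).
      by apply: definable_family_subst dg; substitution_tac.
    by apply: (definable_in_box HM); substitution_tac.
  by definable_tac; apply: (definable_in_box HM); substitution_tac.
apply: (definable_induction HM dB ab Ba) => s as_ sb.
  move=> Bs; have [u [v [us sv Nx]]] := local s as_ (ltW sb).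
  have sv' : beyond true (Fin s) v by [].
  apply: filterS (germ_beyond sv') => s' [/= ss' s'v].
  apply: filterS2 Bs Nx => y H1 H2 t at_ ts'.
  have [ts|st] := leP t s; first exact: H1.
  by apply: H2; [exact: lt_trans st|exact: le_lt_trans s'v].
move=> Hs; have [u [v [us sv Nx]]] := local s (ltW as_) sb.
have su' : beyond false (Fin s) u by [].
have [s' [Bs' [/= s's us']]] := filter_ex (filterI Hs (germ_beyond su')).
apply: filterS2 Bs' Nx => y H1 H2 t at_ ts.
have [ts'|st] := leP t s'; first exact: H1.
by apply: H2; [exact: lt_trans st|exact: le_lt_trans sv].
Qed.

End Space.
End Curves.

(** * Closed maps with definably compact fibers are proper *)

Section Proper.
Context (L : language) (d : Order.disp_t) (M : orderTopologicalType d).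
Variable S : structure L M.
Hypothesis HM : o_minimal S.

Let M0 : inhabited M := om_inhabited HM.

Section Space.
Variable X : definable_space S.

Lemma definable_singleton (x : X) : definable_subset [set x].
Proof.
move=> i; apply/(definable_predP _ M0).
apply: (definable_pred_ext (P := fun z : 'rV_(chart_dim i) =>
  chart_dom i x /\ z = chart i x)).
  by move=> z; split=> [[Dx ->]|[_ [-> Dx] <-]]; first by exists x.
by apply: definable_and; [exact: definable_cst|definable_tac].
Qed.

Lemma germ_oint s (a b : endpoint M) : endpoint_lt a b ->
  germ s (if s then a else b) (oint a b).
Proof.
move=> /(oint_nonempty HM)[t [at_ tb]]; exists t; first by case: s.
case: s => u /= H1 H2; split=> //.
  exact: (@endpoint_lt_trans _ _ (Fin u) (Fin t)).
exact: (@endpoint_lt_trans _ _ a (Fin t)).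
Qed.

Lemma completableP (C : set X) a b (alpha : M -> X) :
  (forall s, exists2 x, C x & alpha @ germ s (if s then a else b) --> x) ->
  completable C a b alpha.
Proof. by move=> H; split; [have := H true|have := H false]; rewrite germE. Qed.

Lemma definably_compact_singleton (x : X) : definably_compact [set x].
Proof.
move=> a b alpha [ab Ca _ _]; apply: completableP => s; exists x => // A Ax.
have [c ec H] := germ_oint s ab; exists c => // t et tc.
rewrite /preimage /=; have -> : alpha t = x by apply: Ca; exists t => //; exact: H.
exact: nbhs_singleton.
Qed.

Lemma definable_image (Q : M -> Prop) (g : M -> X) : definable_pred S Q ->
  definable_family g -> definable_subset (g @` [set t | Q t]).
Proof.
move=> dQ dg i; apply/(definable_predP _ M0).
apply: (definable_pred_ext (P := fun z : 'rV_(chart_dim i) => exists t,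
   Q t /\ (chart_dom i (g t) /\ chart i (g t) = z))).
  move=> z; split=> [[t [Qt [Dt <-]]]|[_ [[t Qt <-] Dt] <-]]; last by exists t.
  by exists (g t) => //; split=> //; exists t.
apply: (definable_exists M0); apply: definable_and => /=.
  by apply: (definable_subst _ dQ); substitution_tac.
apply: (definable_subst (tau := fun p : 'rV_(chart_dim i) * M => (p.2, p.1)) _ (dg i)).
by substitution_tac.
Qed.

End Space.

Lemma definable_preimage (X Y : definable_space S) (f : X -> Y) (B : set Y) :
  definable_map f -> definable_subset B -> definable_subset (f @^-1` B).
Proof.
move=> df dB i; apply/(definable_predP _ M0).
apply: (definable_pred_ext (P := fun z : 'rV_(chart_dim i) => exists j,
  exists w, [set row_mx (chart i x) (chart j (f x)) |
      x in chart_dom i `&` f @^-1` chart_dom j] (row_mx z w) /\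
    (chart j @` (B `&` chart_dom j)) w)).
  move=> z; split=> [[j [w [[x [Dx Dfx] /eq_row_mx[<- <-]]]]]|[x [Bx Dx] <-]].
    by move=> [y [By Dy] /(chart_inj Dy Dfx) yfx]; exists x => //; split=> //; rewrite /= -yfx.
  have [j Dj] := in_some_chart (f x); exists j, (chart j (f x)).
  by split; [exists x|exists (f x)].
apply: (definable_exists_finite M0) => j; apply: (definable_exists_row M0).
apply: definable_and; first by apply: (definable_mem (df i j)); substitution_tac.
by apply: (definable_mem (dB j)); substitution_tac.
Qed.

(** A point outside the image has a neighborhood avoided by [g] near the end
[e], because it is not a limit there, and another one avoided by [g] on the
remaining closed segment. *)
Lemma closed_image_of_escaping_curve (X : definable_space S) (g : M -> X) s e c :
  hausdorff_space X -> definable_family g -> beyond s e c ->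
  (forall t, beyond s e t -> ~~ oriented_lt s c t -> {for t, continuous g}) ->
  (forall x : X, ~ (g @ germ s e --> x)) ->
  closed (g @` [set t | beyond s e t /\ ~~ oriented_lt s c t]).
Proof.
move=> HX dg ec cg nlim; set A := g @` _.
suff clA : closure A `<=` A.
  by rewrite closure_id; apply/seteqP; split; [exact: subset_closure|].
move=> x Ax; apply: contrapT => nAx.
have [N1 xN1 [c1 ec1 gN1]] := family_escape HM dg ec (nlim x).
(* The segment between c1 and c; it is empty when c lies between e and c1. *)
pose lo := if s then c1 else c; pose hi := if s then c else c1.
have seg t : (lo <= t)%O -> (t <= hi)%O -> beyond s e t /\ ~~ oriented_lt s c t.
  rewrite /lo /hi; move: ec ec1; case: (s) => /= ec ec1 lot thi; rewrite -leNgt; split=> //.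
    move: lot; rewrite le_eqVlt => /predU1P[<- //|c1t]; exact: (@endpoint_lt_trans _ _ e (Fin c1)).
  by move: thi; rewrite le_eqVlt => /predU1P[-> //|tc1];
    exact: (@endpoint_lt_trans _ _ (Fin t) (Fin c1)).
have xN2 : nbhs x (fun y => forall t, (lo <= t)%O -> (t <= hi)%O -> g t <> y).
  have [lohi|hilo] := leP lo hi; last first.
    apply: filterE => y t lot thi.
    by have := lt_le_trans hilo (le_trans lot thi); rewrite ltxx.
  apply: (nbhs_avoiding_segment HM) => // t lot thi.
    by have [] := seg t lot thi; exact: cg.
  by move=> gtx; apply: nAx; exists t => //; exact: seg.
have [y [[t [et ct] <-] [N1t N2t]]] := Ax _ (filterI xN1 xN2).
have [tc1|ntc1] := boolP (oriented_lt s t c1); first exact: (gN1 t et tc1).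
apply: (N2t t) => //; move: ct ntc1; rewrite /lo /hi.
  by case: (s) => /=; rewrite -!leNgt.
by case: (s) => /=; rewrite -!leNgt.
Qed.

(** The image in [K] of a curve in the preimage of [K] has a limit.  If the
curve itself had none, it would leave the fiber of this limit, which is
definably compact, and a final segment of it would be a closed set whose image
is not closed. *)
Lemma definably_closed_proper (X Y : definable_space S) (f : X -> Y) :
  hausdorff_space X -> hausdorff_space Y -> continuous f -> definable_map f ->
  definably_closed f -> definably_compact_fibers f -> definably_proper f.
Proof.
move=> HX HY cf df clf fibf K dK Kc; split; first exact: definable_preimage.
move=> a b alpha Calpha; have [ab _ _ _] := Calpha.
have [g [dg Cg gE cg]] := definable_curve_family HM Calpha.
apply: completableP => s; set e := if s then a else b.
have abg : germ s e (oint a b) by exact: germ_oint.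
have [c ec] : exists c, beyond s e c by have [c ec _] := abg; exists c.
have PF := germ_proper HM ec.
have dfg : definable_family (fun t => f (g t)) by exact: definable_family_comp.
have [y Ky fgy] : exists2 y, K y & (fun t => f (g t)) @ germ s e --> y.
  by apply: (family_limit HM Kc dfg ec); apply: filterE => t; exact: Cg.
suff [x gx] : exists x : X, g @ germ s e --> x.
  exists x; last first.
    move=> A /gx; apply: filterS2 abg => t abt; rewrite /preimage /= gE //.
  have fgx : (fun t => f (g t)) @ germ s e --> f x.
    by apply: cvg_comp gx _; exact: cf.
  by rewrite /preimage /= (cvg_unique HY fgx fgy).
apply: contrapT => nlim.
have dfib : definable_pred S (fun t => [set y] (f (g t))).
  by apply: (definable_family_mem HM (c := fun t => f (g t))) => //; exact: definable_singleton.
have [fib|nfib] := germ_ultra HM ec dfib.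
  have [_ fibc] := fibf y.
  by have [x _ gx] := family_limit HM fibc dg ec fib; apply: nlim; exists x.
have [c' ec' H] := filterI abg nfib.
have [c0 ec0 c0c'] := beyond_dense HM ec'.
have HR t : beyond s e t -> ~~ oriented_lt s c0 t -> oint a b t /\ f (g t) <> y.
  move=> et tc0; apply: H => //.
  have [tc|tE|H'] := oriented_ltP s t c0; [exact: (oriented_lt_trans tc)|by rewrite tE|].
  by rewrite H' in tc0.
have clA := closed_image_of_escaping_curve HX dg ec0
  (fun t et tc => cg t (HR t et tc).1) (fun x gx => nlim (ex_intro _ x gx)).
have dR : definable_pred S (fun t => beyond s e t /\ ~~ oriented_lt s c0 t).
  apply: definable_and; first by apply: (definable_beyond HM); substitution_tac.
  apply: (definable_pred_ext (P := fun t => ~ oriented_lt s c0 t)).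
    by move=> t; split=> /negP.
  by apply: definable_not; apply: definable_oriented_lt; substitution_tac.
have := clf _ (definable_image dR dg) clA; rewrite closure_id => clfA.
have : closure (f @` (g @` [set t | beyond s e t /\ ~~ oriented_lt s c0 t])) y.
  move=> B yB; have [t [[et tc0] Bt]] := filter_ex (filterI (germ_beyond ec0) (fgy _ yB)).
  exists (f (g t)); split=> //; exists (g t) => //; exists t => //; split=> //.
  apply/negP => c0t; have := oriented_lt_trans tc0 c0t; by rewrite oriented_lt_irr.
by rewrite -clfA => -[_ [t [et tc] <-] /(HR t et tc).2].
Qed.

End Proper.

(** * Proper maps are closed *)

Section IteratedLimit.
Context (L : language) (d : Order.disp_t) (M : orderTopologicalType d).
Variable S : structure L M.
Hypothesis HM : o_minimal S.

Let M0 : inhabited M := om_inhabited HM.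

Definition update N (v : 'rV[M]_N) (k : 'I_N) (t : M) : 'rV[M]_N :=
  (\row_j if j == k then t else v ord0 j)%R.

Lemma substitution_update N (K : Type) {cK : context M K} (v : K -> 'rV[M]_N) k (t : K -> M) :
  substitution v -> substitution t -> substitution (fun x => update (v x) k (t x)).
Proof. by move=> sv st; rewrite /update; substitution_tac. Qed.

Variables (X : definable_space S) (C : set X).
Hypothesis HX : hausdorff_space X.
Hypothesis Cc : definably_compact C.
Variables (N : nat) (s : 'I_N -> bool) (y : 'rV[M]_N).

(** Limits are unique in the Hausdorff space [X], so the limit in one
coordinate is a function of the others; its graph is definable because
convergence can be tested on boxes. *)
Lemma coordinate_limit (c : 'rV[M]_N -> X) k : definable_family c -> (forall v, C (c v)) ->
  exists c' : 'rV[M]_N -> X, [/\ definable_family c', forall v, C (c' v) &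
    forall v, (fun t => c (update v k t)) @ germ (s k) (Fin (y ord0 k)) --> c' v].
Proof.
move=> dc Cc0; set G := germ _ _.
have [w yw] := oriented_no_max HM (s k) (y ord0 k).
have PF : ProperFilter G by exact: (germ_Fin_proper HM).
have dcu (K : Type) (cK : context M K) (v : K -> 'rV[M]_N) (t : K -> M) :
    substitution v -> substitution t -> definable_family (fun x => c (update (v x) k (t x))).
  by move=> sv st; apply: (definable_family_subst _ dc); exact: substitution_update.
have /choice[c' c'P] v : exists x, C x /\ (fun t => c (update v k t)) @ G --> x.
  have dcv : definable_family (fun t => c (update v k t)) by apply: dcu; substitution_tac.
  have yw' : beyond (s k) (Fin (y ord0 k)) w by rewrite beyond_Fin.
  have [|x Cx cx] := family_limit HM Cc dcv yw'; first by apply: filterE => t; exact: Cc0.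
  by exists x.
exists c'; split=> [i|v|v]; last 2 first; [by have [] := c'P v|by have [] := c'P v|].

apply: (definable_pred_ext (P := fun p : 'rV[M]_N * 'rV[M]_(chart_dim i) =>
  (chart i @` chart_dom i) p.2 /\ forall a b, in_box a b p.2 ->
  G (fun t => chart_dom i (c (update p.1 k t)) /\
              in_box a b (chart i (c (update p.1 k t)))))).
  move=> [v z] /=; split=> [[[x Dx <-] H]|[Dc' <-]].
    suff -> : c' v = x by [].
    apply: (cvg_unique HX (F := (fun t => c (update v k t)) @ G)); first by have [] := c'P v.
    move=> A /(nbhs_chartP HM _ Dx)[a [b [xab abA]]].
    by apply: filterS (H a b xab) => t [Dt /(abA _ Dt)].
  split; first by exists (c' v).
  move=> a b c'ab; have [_ cc'] := c'P v.
  apply: (cc' (fun x => chart_dom i x /\ in_box a b (chart i x))).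
  by apply/(nbhs_chartP HM _ Dc'); exists a, b.
apply: definable_and; first by apply: (definable_mem (chart_image_definable i)); substitution_tac.
apply: (definable_forall_row M0) => /=; apply: (definable_forall_row M0) => /=.
apply: definable_imp; first by apply: (definable_in_box HM); substitution_tac.
pose K := ('rV[M]_N * 'rV[M]_(chart_dim i) * 'rV[M]_(chart_dim i) * 'rV[M]_(chart_dim i))%type.
apply: (definable_germ_Fin HM (K := K) (s k) (tau := fun=> y ord0 k)
  (P := fun x t => chart_dom i (c (update x.1.1.1 k t)) /\
                   in_box x.1.2 x.2 (chart i (c (update x.1.1.1 k t))))).
  substitution_tac.
apply: (definable_family_pred HM (c := fun p : K * M => c (update p.1.1.1.1 k p.2))
  (Q := fun p z => in_box p.1.1.2 p.1.2 z)).
  by apply: dcu; substitution_tac.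
by apply: (definable_in_box HM); substitution_tac.
Qed.

(** One coordinate of [ks] after the other is sent to its end.  The parameter
[u] bounds how close [v] is to [y] in these coordinates, so the conclusion
describes the convergence of [c] to [z] without naming the successive limits. *)
Lemma iterated_limit (ks : seq 'I_N) (c : 'rV[M]_N -> X) (v0 : 'rV[M]_N) :
  definable_family c -> (forall v, C (c v)) ->
  exists2 z, C z & forall (W : set X) (u : 'rV[M]_N), open W -> W z ->
    (forall k, oriented_lt (s k) (y ord0 k) (u ord0 k)) ->
    exists2 v : 'rV[M]_N, W (c v) & forall k, k \in ks ->
      oriented_lt (s k) (y ord0 k) (v ord0 k) /\ oriented_lt (s k) (v ord0 k) (u ord0 k).
Proof.
elim: ks c => [|k ks IH] c dc Cc0.
  by exists (c v0) => // W u _ Wc _; exists v0.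
have [c' [dc' Cc' cc']] := coordinate_limit k dc Cc0.
have [z Cz zP] := IH c' dc' Cc'; exists z => // W u oW Wz yu.
have [v Wv vP] := zP W u oW Wz yu.
have PF := germ_Fin_proper HM (s k) (y ord0 k).
have yuk : beyond (s k) (Fin (y ord0 k)) (u ord0 k) by rewrite beyond_Fin.
have Wc : nbhs (c' v) W by apply: open_nbhs_nbhs.
have Wct : germ (s k) (Fin (y ord0 k)) (fun t => W (c (update v k t))) := cc' v _ Wc.
have [t [Wt [yt tu]]] := filter_ex (filterI Wct (germ_beyond yuk)).
exists (update v k t) => // l; rewrite inE mxE.
case: eqP => [-> _|_ /= lks]; last exact: vP.
by rewrite -beyond_Fin.
Qed.

End IteratedLimit.

Section ProperClosed.
Context (L : language) (d : Order.disp_t) (M : orderTopologicalType d).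
Variable S : structure L M.
Hypothesis HM : o_minimal S.
Hypothesis HS : has_definable_Skolem_functions S.

Let M0 : inhabited M := om_inhabited HM.

(** A point [v] of [M^(n + n)] encodes a box through its lower and upper
corners, so the first [n] coordinates tend to the center from the left and the
others from the right. *)
Definition box_side n (k : 'I_(n + n)) : bool := n <= k.

Lemma box_oriented n (z : 'rV[M]_n) (v : 'rV[M]_(n + n)) :
  in_box (lsubmx v) (rsubmx v) z <->
  forall k, oriented_lt (box_side k) (row_mx z z ord0 k) (v ord0 k).
Proof.
split=> [H k|H k].
  case: (split_ordP k) => j ->; rewrite ?row_mxEl ?row_mxEr /box_side /=.
    by rewrite leqNgt ltn_ord; have [] := H j; rewrite !mxE.
  by rewrite leq_addr; have [] := H j; rewrite !mxE.
split.
  by have := H (lshift n k); rewrite row_mxEl /box_side /= leqNgt ltn_ord mxE.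
by have := H (rshift n k); rewrite row_mxEr /box_side /= leq_addr mxE.
Qed.

(** Skolem functions apply to subsets of powers of [M], hence the fixed
chart [i]: the choice is made on coordinates and transported to [X].  Boxes
that do not contain [y] all receive the same point [x0], so that [c] is
total; the box [b0] keeps every image in a prescribed neighborhood of [y]. *)
Lemma definable_box_choice (X Y : definable_space S) (f : X -> Y) (B : set X) i j
    (y : 'rV[M]_(@chart_dim _ _ _ _ Y j)) (b0 : 'rV[M]_(chart_dim j + chart_dim j)) :
  definable_map f -> definable_subset B ->
  in_box (lsubmx b0) (rsubmx b0) y ->
  (forall v, in_box (lsubmx v) (rsubmx v) y -> exists x,
     [/\ B x, @chart_dom _ _ _ _ X i x, chart_dom j (f x),
         in_box (lsubmx v) (rsubmx v) (chart j (f x)) &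
         in_box (lsubmx b0) (rsubmx b0) (chart j (f x))]) ->
  exists c : 'rV[M]_(chart_dim j + chart_dim j) -> X, [/\ definable_family c,
    forall v, [/\ B (c v), chart_dom j (f (c v)) &
      in_box (lsubmx b0) (rsubmx b0) (chart j (f (c v)))] &
    forall v, in_box (lsubmx v) (rsubmx v) y ->
      in_box (lsubmx v) (rsubmx v) (chart j (f (c v)))].
Proof.
move=> df dB yb0 ex; set n := chart_dim j.
pose good v x := [/\ B x, chart_dom i x, chart_dom j (f x),
  in_box (lsubmx v) (rsubmx v) (chart j (f x)) &
  in_box (lsubmx b0) (rsubmx b0) (chart j (f x))].
pose T : set 'rV[M]_(n + n) := [set v | in_box (lsubmx v) (rsubmx v) y].
pose F (v : 'rV[M]_(n + n)) : set 'rV[M]_(chart_dim i) := chart i @` [set x | good v x].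
have dT : definable S T.
  by apply/(definable_predP _ M0); apply: (definable_in_box HM); substitution_tac.
have dF : definable S [set w : 'rV[M]_(n + n + chart_dim i) |
    T (lsubmx w) /\ F (lsubmx w) (rsubmx w)].
  apply/(definable_predP _ M0); apply: definable_and.
    by apply: (definable_mem dT); substitution_tac.
  apply: (definable_pred_ext (P := fun w : 'rV[M]_(n + n + chart_dim i) =>
    (chart i @` (B `&` chart_dom i)) (rsubmx w) /\ exists z,
    [set row_mx (chart i x) (chart j (f x)) | x in chart_dom i `&` f @^-1` chart_dom j]
      (row_mx (rsubmx w) z) /\
    in_box (lsubmx (lsubmx w)) (rsubmx (lsubmx w)) z /\ in_box (lsubmx b0) (rsubmx b0) z)).
    move=> w; split=> [[[x [Bx Dx] xw]
      [z [[x' [Dx' Dfx'] /eq_row_mx[]]]]]|[x [Bx Dx Dfx xv xb0] <-]].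
      rewrite -xw => /(chart_inj Dx' Dx) ? <- [xv xb0]; subst x'.
      by exists x.
    split; first by exists x.
    exists (chart j (f x)); split=> //; by exists x.
  apply: definable_and; first by apply: (definable_mem (dB i)); substitution_tac.
  apply: (definable_exists_row M0); apply: definable_and => /=.
    by apply: (definable_mem (df i j)); substitution_tac.
  by apply: definable_and; apply: (definable_in_box HM); substitution_tac.
have exF v : T v -> F v !=set0.
  by move=> /ex[x xP]; exists (chart i x), x.
have [phi [dphi phiP]] := HS dT dF exF.
have [x0 x0P] := ex b0 yb0.
have /choice[c cP] v : exists x, [/\ T v -> good v x /\ chart i x = phi v & ~ T v -> x = x0].
  have [Tv|nTv] := pselect (T v); last by exists x0.
  by have [x xP xphi] := phiP v Tv; exists x; split.
exists c; split=> [i'|v|v Tv].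
- apply: (definable_pred_ext (P := fun p : 'rV[M]_(n + n) * 'rV[M]_(chart_dim i') =>
    (T p.1 /\ exists z, [set row_mx (id v) (phi v) | v in T] (row_mx p.1 z) /\
      [set row_mx (chart i x) (chart i' x) | x in chart_dom i `&` chart_dom i']
        (row_mx z p.2)) \/
    (~ T p.1 /\ chart_dom i' x0 /\ p.2 = chart i' x0))).
    move=> [v z] /=; have [cT cnT] := cP v; split.
      case=> [[Tv [z' [[v' Tv' /eq_row_mx[/= ? <-]] [x [Dx Dx'] /eq_row_mx[]]]]]|].
        subst v'; have [[_ Dc _ _ _] <-] := cT Tv.
        by move=> /(chart_inj Dx Dc) <- <-.
      by move=> [/cnT -> [? ->]].
    move=> [Dc' <-]; have [Tv|nTv] := pselect (T v).
      left; split=> //; have [[_ Dc _ _ _] cphi] := cT Tv.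
      by exists (phi v); split; [exists v|exists (c v) => //; rewrite cphi].
    by right; move: Dc'; rewrite cnT.
  apply: definable_or.
    apply: definable_and; first by apply: (definable_mem dT); substitution_tac.
    apply: (definable_exists_row M0); apply: definable_and => /=.
      by apply: (definable_mem dphi); substitution_tac.
    by apply: (definable_mem (transition_definable i i')); substitution_tac.
  apply: definable_and.
    by apply: definable_not; apply: (definable_mem dT); substitution_tac.
  by apply: definable_and; [exact: definable_cst|definable_tac].
- have [cT cnT] := cP v; have [Tv|nTv] := pselect (T v).
    by have [[]] := cT Tv.
  by rewrite cnT //; case: x0P.
- by have [cT _] := cP v; have [[]] := cT Tv.
Qed.

(** The final point of the iterated limit, taken over all sides of a box
around [y], is a preimage of [y] in [A]. *)
Lemma definably_proper_closed (X Y : definable_space S) (f : X -> Y) :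
  hausdorff_space X -> hausdorff_space Y -> locally_definably_compact Y ->
  continuous f -> definable_map f -> definably_proper f -> definably_closed f.
Proof.
move=> HX HY lcY cf df pf A dA clA; rewrite closure_id.
apply/seteqP; split=> [|y yA]; first exact: subset_closure.
have [K [dK Kc yK]] := lcY y.
have [j Dy] := in_some_chart y.
(* Finitely many charts cover A, so y is adherent to the image of the part of
   A in one of them. *)
have [i yi] : exists i, closure (f @` (A `&` chart_dom i)) y.
  apply: contrapT => nex.
  have /filter_forall_ord : forall i : 'I_(nb_charts X),
      nbhs y (fun y' => ~ (f @` (A `&` chart_dom i)) y').
    move=> i; apply: contrapT => nN; apply: nex; exists i => V yV.
    apply: contrapT => nV; apply: nN; apply: filterS yV => y' Vy' fy'.
    by apply: nV; exists y'.
  move=> /yA[_ [[x Ax <-] H]]; have [i Dx] := in_some_chart x.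
  by apply: (H i); exists x.
have [p0 [q0 [ypq pqK]]] := (nbhs_chartP HM K Dy).1 yK.
pose b0 := row_mx p0 q0.
have yb0 : in_box (lsubmx b0) (rsubmx b0) (chart j y) by rewrite row_mxKl row_mxKr.
have [v|c [dc cP cv]] := definable_box_choice (i := i) df dA yb0.
  move=> yv.
  have N1 : nbhs y (fun y' => chart_dom j y' /\ in_box (lsubmx v) (rsubmx v) (chart j y')).
    by apply/(nbhs_chartP HM _ Dy); exists (lsubmx v), (rsubmx v).
  have N2 : nbhs y (fun y' => chart_dom j y' /\ in_box (lsubmx b0) (rsubmx b0) (chart j y')).
    by apply/(nbhs_chartP HM _ Dy); exists (lsubmx b0), (rsubmx b0).
  by have [_ [[x [Ax Dx] <-] [[Dfx xv] [_ xb0]]]] := yi _ (filterI N1 N2); exists x.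
have [_ fKc] := pf K dK Kc.
have fcK v : (f @^-1` K) (c v).
  have [_ Dc cb0] := cP v; apply: pqK => //.
  by move: cb0; rewrite row_mxKl row_mxKr.
have [z _ zP] := iterated_limit HM HX fKc (@box_side _) (row_mx (chart j y) (chart j y))
  (enum 'I_(chart_dim j + chart_dim j)) b0 dc fcK.
have lim (W : set X) (u : 'rV[M]_(chart_dim j + chart_dim j)) : open W -> W z ->
    in_box (lsubmx u) (rsubmx u) (chart j y) -> exists v, [/\ W (c v),
      chart_dom j (f (c v)) & in_box (lsubmx u) (rsubmx u) (chart j (f (c v)))].
  move=> oW Wz /box_oriented yu.
  have [v Wv vP] := zP W u oW Wz yu; exists v; split=> //; first by case: (cP v).
  have /cv/box_oriented cvv : in_box (lsubmx v) (rsubmx v) (chart j y).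
    by apply/box_oriented => k; have [] := vP k (mem_enum _ _).
  apply/box_oriented => k; apply: oriented_lt_trans (cvv k) _.
  by have [] := vP k (mem_enum _ _).
have Az : A z.
  have -> : A = closure A by rewrite -closure_id.
  move=> V; rewrite nbhsE => -[W [oW Wz] WV].
  have [v [Wv _ _]] := lim W b0 oW Wz yb0.
  by exists (c v); split; [case: (cP v)|exact: WV].
exists z => //; apply: contrapT => fzy.
move: HY; rewrite open_hausdorff => HY'.
have /HY'[[U V] /= [fzU yV] [oU oV /eqP UV]] : f z != y by apply/eqP.
rewrite !inE in fzU yV.
have /(nbhs_chartP HM _ Dy)[p [q [ypq' pqV]]] : nbhs y V by apply: open_nbhs_nbhs.
have oW : open (f @^-1` U) by move/continuousP : cf; apply.
have [v [Uv Dv vpq]] := lim _ (row_mx p q) oW fzU ltac:(by rewrite row_mxKl row_mxKr).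
have : (U `&` V) (f (c v)).
  by split=> //; apply: pqV => //; move: vpq; rewrite row_mxKl row_mxKr.
by rewrite UV.
Qed.

End ProperClosed.

Theorem theorem3p18 (L : language) (d : Order.disp_t)
    (M : orderTopologicalType d) (S : structure L M)
    (HM : o_minimal S) (HS : has_definable_Skolem_functions S)
    (X Y : definable_space S)
    (HX : hausdorff_space X) (HY : hausdorff_space Y)
    (HYlc : locally_definably_compact Y)
    (f : X -> Y) (Hfc : continuous f) (Hfd : definable_map f) :
  definably_proper f <-> definably_closed f /\ definably_compact_fibers f.
Proof.
split=> [pf|[clf fibf]]; last exact: definably_closed_proper.
split; first exact: definably_proper_closed.
by move=> y; apply: pf; [exact: definable_singleton|exact: definably_compact_singleton].
Qed.
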